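(* Let $X$ and $Y$ be separable Banach spaces, $R\in\mathcal{L}(Y)$, $T\in\mathcal{L}(X)$ and $q\in\mathbb{N}$. Let $\mathcal{D}$ be a norm-dense set in $Y$ and let $\Phi$ be a countable weak$^*$-dense set in $X^*$. Suppose that for each $(y,x^* )\in\mathcal{D}\times\Phi$ there exist sequences $(y_n)_{n\ge 0}$ in $Y$ and $(x_n^* )_{n\ge 0}$ in $X^*$ such that (a) the series $\sum_{n=0}^{r} R^{r^q-(r-n)^q}(y)\otimes (T^* )^{r^q-(r-n)^q}(x^* )$ and $\sum_{n=1}^{\infty} y_{(n+r)^q-r^q}\otimes x^*_{(n+r)^q-r^q}$ are unconditionally convergent in $(\mathcal{L}(X,Y),\|\cdot\|_{op})$, uniformly in $r\ge 0$; and (b) $R^{n^q}y_{n^q}=y$, $(T^* )^{n^q}x^*_{n^q}=x^*$, $R^{n^q}y_{m^q}=y_{m^q-n^q}$ and $(T^* )^{n^q}x^*_{m^q}=x^*_{m^q-n^q}$ for all $m>n\ge 0$. Then the following assertions hold. (i) If $T^*(\Phi)\subseteq\Phi$ and, for every $(y,x^* )\in\mathcal{D}\times\Phi$, the sequence $(x_n^* )_{n\ge 0}$ associated with $(y,x^* )$ satisfies $\{x_n^*: n\ge 0\}\subseteq\Phi$, then $C_{R,T}$ is $q$-frequently hypercyclic on $(\mathcal{L}(X,Y),\mathrm{SOT})$. (ii) If $Y$ has the approximation property and the set $\Phi$ is norm-dense in $X^*$, then $C_{R,T}$ is $q$-frequently hypercyclic on $(\mathcal{K}(X,Y),\|\cdot\|_{op})$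 and on $(\mathcal{L}(X,Y),\mathrm{COT})$.
   Context: $\mathbb{N}=\{1,2,\dots\}$. $\mathcal{L}(X,Y)$ (resp. $\mathcal{K}(X,Y)$) is the space of bounded (resp. compact) linear operators from $X$ to $Y$, and $\mathcal{L}(X)=\mathcal{L}(X,X)$. $C_{R,T}$ is the linear map $C_{R,T}(S)=RST$. SOT is the strong operator topology (pointwise convergence); COT is the topology of uniform convergence on compact subsets of $X$; $\|\cdot\|_{op}$ is the operator norm. For $y\in Y$, $x^*\in X^*$, $y\otimes x^*$ is the operator $x\mapsto x^*(x)y$. $Y$ has the approximation property if its identity operator can be approximated by finite-rank bounded operators uniformly on compact sets. A continuous linear operator $A$ on a topological vector space $E$ is $q$-frequently hypercyclic if there is $x\in E$ such that for every non-empty open $U\subset E$ the set $\{n\in\mathbb{N}: A^nx\in U\}$ has positive $q$-lower density, where the $q$-lower density of $M\subset\mathbb{N}$ is $\liminf_{N\to\infty}\frac{\mathrm{card}\{n\in M:\ n\le N^q\}}{N}$. A family of series $\sum_n x_{n,r}$ ($r\ge 0$) in a Banach space is unconditionally convergent uniformly in $r$ if for every $\delta>0$ there is $N\in\mathbb{N}$ with $\|\sum_{n\in F}x_{n,r}\|<\delta$ for all finite $F\subset[N,\infty)$ and all $r$. For finite sums $\sum_{n=0}^r$, the terms with $n>r$ are taken to be $0$. *)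

(* Defs.v *)
From HB Require Import structures.
From mathcomp Require Import all_boot all_order all_algebra finmap.
From mathcomp Require Import complex.
From mathcomp Require Import all_classical all_reals all_analysis.

Set Implicit Arguments.
Unset Strict Implicit.
Unset Printing Implicit Defensive.

Import Order.TTheory GRing.Theory Num.Def Num.Theory.
Import numFieldTopology.Exports numFieldNormedType.Exports.

Local Open Scope classical_set_scope.
Local Open Scope ring_scope.

Variant scalars := RealScalars | ComplexScalars.

Definition scalar_field (R : realType) (s : scalars) : numFieldType :=
  match s with RealScalars => R | ComplexScalars => R[i] end.

(* Both fields have suprema of bounded sets of nonnegative scalars; over R[i]
   the order compares only numbers with the same imaginary part. *)
Lemma nneg_has_sup (R : realType) (s : scalars) (A : set (scalar_field R s)) :
  A !=set0 -> (forall a, A a -> 0 <= a) -> ubound A !=set0 ->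
  supremums A !=set0.
Proof.
case: s A => /= A [a Aa] A0 [M AM].
  have hs : has_sup A by split; [exists a | exists M].
  exists (sup A); split.
    by move=> x Ax; exact: (sup_upper_bound hs).
  by move=> x xA; apply: ge_sup => //; exists a.
have AE x : A x -> x = (complex.Re x)%:C%C.
  move=> /A0; rewrite lecE => /andP[/eqP]; case: x => x1 x2 /= -> _ //.
pose B := [set complex.Re x | x in A].
have hs : has_sup B.
  split; first by exists (complex.Re a), a.
  exists (complex.Re M) => _ [x Ax <-].
  by have := AM _ Ax; rewrite lecE => /andP[].
exists (sup B)%:C%C; split.
  move=> x Ax; rewrite (AE _ Ax) lecR.
  by apply: sup_upper_bound => //; exists x.
move=> x xA; rewrite lecE /=; apply/andP; split.
  have := xA _ Aa; rewrite lecE => /andP[/eqP -> _].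
  by rewrite (AE _ Aa).
apply: ge_sup; first by exists (complex.Re a), a.
move=> _ [y Ay <-]; by have := xA _ Ay; rewrite lecE => /andP[].
Qed.

Section bounded_operators.
Context {K : numFieldType} {X Y : normedModType K}.

Definition bounded_linear : {pred X -> Y} := mem
  [set f : X -> Y | linear f /\ exists M, forall x, `|f x| <= M * `|x|].

Lemma bounded_linear_submod : submod_closed bounded_linear.
Proof.
split=> [|a f g].
  apply/mem_set; split; first by move=> c u v; rewrite /= scaler0 addr0.
  by exists 0 => x; rewrite normr0 mul0r.
move=> /set_mem[lf [M fM]] /set_mem[lg [N gN]]; apply/mem_set; split.
  move=> c u v; change (a *: f (c *: u + v) + g (c *: u + v)
     = c *: (a *: f u + g u) + (a *: f v + g v)).
  rewrite lf lg !scalerDr !scalerA (mulrC a c) -!addrA; congr (_ + _).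
  by rewrite addrCA.
exists (`|a| * M + N) => x; change (`|a *: f x + g x| <= (`|a| * M + N) * `|x|).
by rewrite (le_trans (ler_normD _ _))// normrZ mulrDl lerD// -mulrA ler_wpM2l.
Qed.

HB.instance Definition _ :=
  GRing.isSubmodClosed.Build K (X -> Y) bounded_linear bounded_linear_submod.

End bounded_operators.

Record bounded_op {K : numFieldType} (X Y : normedModType K) := BoundedOp {
  bop_fun :> X -> Y;
  bop_funP : bop_fun \in bounded_linear
}.
Arguments BoundedOp {K X Y} bop_fun bop_funP.

Section bounded_op_lmod.
Context {K : numFieldType} {X Y : normedModType K}.

HB.instance Definition _ := [isSub for (@bop_fun K X Y)].
HB.instance Definition _ := [Choice of bounded_op X Y by <:].
HB.instance Definition _ := [SubChoice_isSubLmodule of bounded_op X Y by <:].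


Lemma bop_linear (S : bounded_op X Y) : linear S.
Proof. by case: (set_mem (bop_funP S)). Qed.

HB.instance Definition _ (S : bounded_op X Y) :=
  GRing.isLinear.Build K X Y _ S (bop_linear S).

Lemma bop_bounded (S : bounded_op X Y) : exists2 M, 0 <= M &
  forall x, `|S x| <= M * `|x|.
Proof.
case: (set_mem (bop_funP S)) => _ [M SM].
have [x0|] := pselect (exists x : X, x != 0); last first.
  move=> X0; exists 0 => // x; have [->|xn0] := eqVneq x 0.
    by rewrite linear0 !normr0 mulr0.
  by case: X0; exists x.
exists M => //; case: x0 => x x0.
by rewrite -(@pmulr_lge0 _ `|x|) ?normr_gt0// (le_trans _ (SM x)).
Qed.

End bounded_op_lmod.

Section constructions.
Context {K : numFieldType}.

Lemma comp_op_subproof {X Y Z : normedModType K} (A : bounded_op Y Z)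
  (B : bounded_op X Y) : (A \o B) \in bounded_linear.
Proof.
apply/mem_set; split; first by move=> c u v; rewrite /= !linearP.
have [M M0 AM] := bop_bounded A; have [N _ BN] := bop_bounded B.
by exists (M * N) => x; rewrite (le_trans (AM _))// -mulrA ler_wpM2l.
Qed.

Definition comp_op {X Y Z : normedModType K} (A : bounded_op Y Z)
  (B : bounded_op X Y) : bounded_op X Z := BoundedOp _ (comp_op_subproof A B).

Definition dual (X : normedModType K) := bounded_op X K^o.

Definition adjoint {X : normedModType K} (T : bounded_op X X) (phi : dual X) :
  dual X := comp_op phi T.

Lemma rank_one_subproof {X Y : normedModType K} (y : Y) (phi : dual X) :
  (fun x => phi x *: y) \in @bounded_linear K X Y.
Proof.
apply/mem_set; split; first by move=> c u v; rewrite /= linearP scalerDl scalerA.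
have [M _ phiM] := bop_bounded phi.
by exists (M * `|y|) => x; rewrite normrZ mulrAC ler_wpM2r.
Qed.

(* y ⊗ phi *)
Definition rank_one {X Y : normedModType K} (y : Y) (phi : dual X) :
  bounded_op X Y := BoundedOp _ (rank_one_subproof y phi).

Definition conj_op {X Y : normedModType K} (R : bounded_op Y Y)
  (T : bounded_op X X) (S : bounded_op X Y) : bounded_op X Y :=
  comp_op R (comp_op S T).

End constructions.

Section operator_norm.
Context {R : realType} {s : scalars}.
Local Notation K := (scalar_field R s).
Context {X Y : normedModType K}.

Implicit Types S : bounded_op X Y.

(* The norms take values in K, so the supremum is taken for the order of K. *)
Definition op_norm (S : bounded_op X Y) : K :=
  supremum 0 [set `|S x| | x in [set x | `|x| <= 1]].

Lemma op_norm_sup S :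
  supremums [set `|S x| | x in [set x | `|x| <= 1]] (op_norm S).
Proof.
have ne : [set `|S x| | x in [set x | `|x| <= 1]] !=set0.
  by exists `|S 0|, 0 => //=; rewrite normr0.
rewrite /op_norm /supremum; case: ifPn => [/eqP E|_].
  by move: ne; rewrite E => -[].
apply: xgetPex; apply: nneg_has_sup => //; first by move=> _ [x _ <-].
have [M M0 SM] := bop_bounded S; exists M => _ [x x1 <-].
by rewrite (le_trans (SM x))// ler_piMr.
Qed.

Lemma op_norm_le1 S x : `|x| <= 1 -> `|S x| <= op_norm S.
Proof. by move=> x1; have [ub _] := op_norm_sup S; apply: ub; exists x. Qed.

Lemma op_norm_lub S M : (forall x, `|x| <= 1 -> `|S x| <= M) -> op_norm S <= M.
Proof. by move=> SM; have [_ ] := op_norm_sup S; apply=> _ [x x1 <-]; apply: SM. Qed.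

Lemma op_norm_ge0 S : 0 <= op_norm S.
Proof. by rewrite (le_trans _ (@op_norm_le1 S 0 _))// normr0. Qed.

Lemma op_normP S x : `|S x| <= op_norm S * `|x|.
Proof.
have [->|x0] := eqVneq x 0; first by rewrite linear0 !normr0 mulr0.
have nx : 0 < `|x| by rewrite normr_gt0.
have := @op_norm_le1 S (`|x|^-1 *: x).
rewrite linearZ !normrZ normfV normr_id mulVf ?gt_eqF// => /(_ (lexx _)).
by rewrite ler_pdivrMl// mulrC.
Qed.

Lemma op_normD S1 S2 : op_norm (S1 + S2) <= op_norm S1 + op_norm S2.
Proof.
apply: op_norm_lub => x x1; change (`|S1 x + S2 x| <= op_norm S1 + op_norm S2).
by rewrite (le_trans (ler_normD _ _))// lerD// op_norm_le1.
Qed.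

Let op_normZ_le (l : K) S : op_norm (l *: S) <= `|l| * op_norm S.
Proof.
apply: op_norm_lub => x x1; change (`|l *: S x| <= `|l| * op_norm S).
by rewrite normrZ ler_wpM2l// op_norm_le1.
Qed.

Lemma op_normZ (l : K) S : op_norm (l *: S) = `|l| * op_norm S.
Proof.
apply/le_anti; rewrite op_normZ_le /=.
have [->|l0] := eqVneq l 0; first by rewrite normr0 mul0r op_norm_ge0.
by rewrite -ler_pdivlMl ?normr_gt0// -normfV -{1}(scalerK l0 S) op_normZ_le.
Qed.

Lemma op_norm_eq0 S : op_norm S = 0 -> S = 0.
Proof.
move=> S0; apply: val_inj; apply/funext => x; apply/eqP.
by have := op_normP S x; rewrite S0 mul0r normr_le0.
Qed.

HB.instance Definition _ :=
  Lmodule_isNormed.Build K (bounded_op X Y) op_normD op_normZ op_norm_eq0.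

End operator_norm.

Section operator_topologies.
Context {K : numFieldType} (X Y : normedModType K).

(* Strong operator topology: pointwise convergence. *)
Definition sot_op : Type :=
  initial_topology (fun S : bounded_op X Y => (S : {ptws X -> Y})).
HB.instance Definition _ := Topological.copy sot_op
  (initial_topology (fun S : bounded_op X Y => (S : {ptws X -> Y}))).
HB.instance Definition _ := GRing.Lmodule.copy sot_op (bounded_op X Y).

(* Uniform convergence on compact sets. *)
Definition cot_op : Type :=
  initial_topology (fun S : bounded_op X Y => (S : {family compact, X -> Y})).
HB.instance Definition _ := Topological.copy cot_op
  (initial_topology (fun S : bounded_op X Y => (S : {family compact, X -> Y}))).
HB.instance Definition _ := GRing.Lmodule.copy cot_op (bounded_op X Y).

End operator_topologies.

(* The weak* topology is the topology of pointwise convergence on X^*. *)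
Definition weak_star_dual {K : numFieldType} (X : normedModType K) :=
  sot_op X K^o.

Section compact_operators.
Context {R : realType} {s : scalars}.
Local Notation K := (scalar_field R s).

Definition is_compact_op {X Y : normedModType K} : {pred bounded_op X Y} := mem
  [set S : bounded_op X Y | compact (closure (S @` [set x | `|x| <= 1]))].

Lemma compact_opP {X Y : normedModType K} (S : bounded_op X Y) :
  S \in is_compact_op <->
  exists2 C, compact C & forall x, `|x| <= 1 -> C (S x).
Proof.
split=> [/set_mem cS|[C cC SC]].
  by exists (closure (S @` [set x | `|x| <= 1])) => // x x1;
    apply: subset_closure; exists x.
apply/mem_set; apply: (subclosed_compact _ cC); first exact: closed_closure.
rewrite closureE => y; apply; split; last by move=> _ [x x1 <-]; exact: SC.
by apply: compact_closed => //; exact: norm_hausdorff.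
Qed.

Lemma compact_op_submod {X Y : normedModType K} :
  submod_closed (@is_compact_op X Y).
Proof.
split=> [|a S1 S2].
  by apply/compact_opP; exists [set 0]; first exact: compact_set1.
move=> /compact_opP[C cC S1C] /compact_opP[D cD S2D]; apply/compact_opP.
exists [set a *: z.1 + z.2 | z in C `*` D]; last first.
  by move=> x x1; exists (S1 x, S2 x) => //=; split; [exact: S1C|exact: S2D].
apply: continuous_compact; last exact: compact_setX.
apply: continuous_subspaceT => z.
by apply: cvgD; [apply: cvgZr; exact: cvg_fst | exact: cvg_snd].
Qed.

HB.instance Definition _ (X Y : normedModType K) :=
  GRing.isSubmodClosed.Build K (bounded_op X Y) is_compact_op
    (@compact_op_submod X Y).

Lemma conj_op_compact {X Y : normedModType K} (A : bounded_op Y Y)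
    (B : bounded_op X X) (S : bounded_op X Y) :
  S \in is_compact_op -> conj_op A B S \in is_compact_op.
Proof.
move=> /compact_opP[C cC SC]; apply/compact_opP.
have [M M0 BM] := bop_bounded B.
exists [set (M + 1) *: A y | y in C].
  apply: continuous_compact => //; apply: continuous_subspaceT => y.
  apply: cvgZr; apply: bounded_linear_continuous.
  apply/linear_boundedP; have [N N0 AN] := bop_bounded A.
  near=> r => x; rewrite (le_trans (AN x))// ler_wpM2r//.
  by near: r; apply: nbhs_pinfty_ge; rewrite ger0_real.
move=> x x1; have M1 : 0 < M + 1 by rewrite ltr_wpDl.
exists (S ((M + 1)^-1 *: B x)).
  apply: SC; rewrite normrZ normfV gtr0_norm// ler_pdivrMl// mulr1.
  by rewrite (le_trans (BM x))// (le_trans (ler_piMr _ x1))// lerDl.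
by rewrite /= !linearZ/= scalerA mulVf ?scale1r// gt_eqF.
Unshelve. all: by end_near. Qed.

End compact_operators.

Record compact_op {R : realType} {s : scalars}
    (X Y : normedModType (scalar_field R s)) := CompactOp {
  cop_op :> bounded_op X Y;
  cop_opP : cop_op \in is_compact_op
}.

Section compact_op_normed.
Context {R : realType} {s : scalars}.
Local Notation K := (scalar_field R s).
Context {X Y : normedModType K}.

HB.instance Definition _ := [isSub for (@cop_op R s X Y)].
HB.instance Definition _ := [Choice of compact_op X Y by <:].
HB.instance Definition _ := [SubChoice_isSubLmodule of compact_op X Y by <:].

Implicit Types S : compact_op X Y.

Definition compact_op_norm (S : compact_op X Y) : K := op_norm S.

Lemma compact_op_normD S1 S2 :
  compact_op_norm (S1 + S2) <= compact_op_norm S1 + compact_op_norm S2.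
Proof. exact: op_normD. Qed.

Lemma compact_op_normZ (l : K) S :
  compact_op_norm (l *: S) = `|l| * compact_op_norm S.
Proof. exact: op_normZ. Qed.

Lemma compact_op_norm_eq0 S : compact_op_norm S = 0 -> S = 0.
Proof. by move=> /op_norm_eq0 S0; apply: val_inj. Qed.

HB.instance Definition _ := Lmodule_isNormed.Build K (compact_op X Y)
  compact_op_normD compact_op_normZ compact_op_norm_eq0.

Definition conj_compact_op (A : bounded_op Y Y) (B : bounded_op X X)
    (S : compact_op X Y) : compact_op X Y :=
  CompactOp (conj_op_compact A B (cop_opP S)).

End compact_op_normed.

Section notions.
Context {R : realType} {s : scalars}.
Local Notation K := (scalar_field R s).

Definition separable (T : topologicalType) :=
  exists A : set T, countable A /\ dense A.

Definition finite_rank {X Y : normedModType K} (F : bounded_op X Y) :=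
  exists n (b : 'I_n -> Y), forall x, exists c : 'I_n -> K,
    F x = \sum_(i < n) c i *: b i.

Definition approximation_property (Y : normedModType K) :=
  forall (C : set Y) (e : K), compact C -> 0 < e ->
    exists F : bounded_op Y Y,
      finite_rank F /\ forall y, C y -> `|F y - y| < e.

(* The count starts at 1, since 0 is not a natural number here. The term N = 0
   is 0 / 0 = 0 and does not affect the limit inferior, which is taken in the
   extended reals since for q > 1 it may be infinite. *)
Definition q_lower_density (q : nat) (M : set nat) : \bar R :=
  limn_einf (fun N =>
    ((count (fun n => n \in M) (iota 1 (N ^ q)))%:R / N%:R)%:E).

(* Compatibility of the topology of E with its vector space structure plays no
   role in the definition, so it is not required of the type. *)
Definition q_frequently_hypercyclic (q : nat) (E : preTopologicalLmodType K)
    (A : E -> E) :=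
  [/\ linear A, continuous A &
    exists x : E, forall U : set E, open U -> U !=set0 ->
      (0 < q_lower_density q [set n | U (iter n A x)])%E].

(* [x n r] is the n-th term of the r-th series. *)
Definition unconditionally_cvg_uniformly {E : normedModType K}
    (x : nat -> nat -> E) :=
  forall d : K, 0 < d -> exists2 N : nat, (0 < N)%N &
    forall F : {fset nat}, (forall n, n \in F -> (N <= n)%N) ->
      forall r : nat, `|\sum_(n <- F) x n r| < d.

End notions.

(* Main.v *)
Require Import Defs.
From HB Require Import structures.
From mathcomp Require Import all_boot all_order all_algebra finmap.
From mathcomp Require Import complex.
From mathcomp Require Import all_classical all_reals all_analysis.
From mathcomp Require Import zify ring lra.

Set Implicit Arguments.
Unset Strict Implicit.
Unset Printing Implicit Defensive.

Import Order.TTheory GRing.Theory Num.Theory.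
Import numFieldTopology.Exports numFieldNormedType.Exports.

Local Open Scope classical_set_scope.
Local Open Scope ring_scope.

(** Conjugation [S |-> R S T] maps the operator [y (x) phi] of rank one to
    [R y (x) phi \o T]. Hypotheses (a) and (b) therefore concern the orbits of
    these operators under conjugation: (b) provides backward orbits along the
    powers [n ^ q], and (a) says that the contributions of the past and of the
    future seen at a time [r ^ q] are summable in the operator norm, uniformly
    in [r]. Both properties pass to finite sums of the [y (x) phi].

    From this a single operator [S] is built whose orbit comes close, in operator
    norm, to every such finite sum, along sets of times of positive q-lower
    density ([q_frequent_hypercyclicity_criterion]). Enumerate the targets as
    [w k], let [sigma k m] be the backward orbit of [w k], and put
    [S = sum over m of sigma k (spread m ^ q)], where [k] is determined by the
    condition that the 2-adic valuation of [m] be a prescribed level [N k]. The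
    function [spread] separates [m] and [n] by at least the sum of their
    valuations, and satisfies [spread m <= 4 * m]. By the second property the
    integers of a given valuation still form a set of positive lower density
    after [spread] ([q_lower_density_gt0]). By the first one, at the time
    [spread m ^ q] with [m] of valuation [N k] the term of [m] has become [w k],
    while all other terms lie so far in the past or in the future that the tails
    of the series in (a) bound them by a multiple of [2 ^- k]
    ([orbit_sum_limit]).

    As a norm limit of operators of finite rank, [S] is compact. It remains to
    see that the finite sums of the [y (x) phi] are dense in the three operator
    spaces, each of which has a topology of uniform convergence on bounded sets:
    finite sets, compact sets, or the unit ball. Operators of finite rank are
    dense: on a finite set every operator agrees with one of finite rank
    ([interpolation]), and for the other two topologies the approximation
    property applies to the relatively compact image of the set
    ([approx_on_approximation_property]). Operators of finite rank are
    themselves sums of [y (x) phi] with continuous [phi]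
    ([finite_rank_tensor_sum]), and there [y] and [phi] can be taken from the
    given dense sets. Both the interpolation and this decomposition use the
    Hahn-Banach theorem, proved over both scalar fields by minimal sublinear
    functionals ([separating_functional]). *)

(** * Hahn-Banach theorem at a point *)

Section sublinear.
Context {F : realType} {V : lmodType F}.
Implicit Types p : V -> F.

Definition sublinear p :=
  (forall x y, p (x + y) <= p x + p y) /\
  (forall a x, 0 < a -> p (a *: x) <= a * p x).

Lemma sublinearZ p a x : sublinear p -> 0 < a -> p (a *: x) = a * p x.
Proof.
move=> [_ pZ] a0; apply/le_anti; rewrite pZ//=.
rewrite -ler_pdivlMl// -{1}(@scalerK _ _ a _ x) ?gt_eqF// pZ// invr_gt0//.
Qed.

Lemma sublinear0 p : sublinear p -> p 0 = 0.
Proof.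
move=> sp; have := @sublinearZ p 2 0 sp (ltr0n _ 2); rewrite scaler0; lra.
Qed.

Lemma sublinear_geN p x : sublinear p -> - p (- x) <= p x.
Proof.
move=> sp; have := sp.1 x (- x); rewrite subrr sublinear0//; lra.
Qed.

(** The largest sublinear functional below [p] that is affine with slope [p y]
    along every ray in the direction [y]: it flattens [p] in that direction. *)
Definition directional p y x :=
  inf [set p (x + t *: y) - t * p y | t in [set t | 0 <= t]].

(** The infimum defining [directional] is finite: subadditivity bounds
    [p (t *: y)] by [p (x + t *: y) + p (- x)]. *)
Lemma directional_lb p y x t : sublinear p -> 0 <= t ->
  - p (- x) <= p (x + t *: y) - t * p y.
Proof.
move=> sp t0; have := sp.1 (x + t *: y) (- x).
rewrite addrAC subrr add0r.
have -> : p (t *: y) = t * p y; last by lra.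
move: t0; rewrite le_eqVlt => /orP[/eqP<-|t0].
  by rewrite scale0r mul0r sublinear0.
exact: sublinearZ.
Qed.

Lemma directional_le p y x t : sublinear p -> 0 <= t ->
  directional p y x <= p (x + t *: y) - t * p y.
Proof.
move=> sp t0; apply: ge_inf; last by exists t.
by exists (- p (- x)) => _ [u /= u0 <-]; exact: directional_lb.
Qed.

Lemma directional_ge p y x c :
  (forall t, 0 <= t -> c <= p (x + t *: y) - t * p y) -> c <= directional p y x.
Proof.
move=> h; apply: lb_le_inf; first by exists (p (x + 0 *: y) - 0 * p y); exists 0 => //=.
by move=> _ [t /= t0 <-]; exact: h.
Qed.

Lemma directional_le_id p y x : sublinear p -> directional p y x <= p x.
Proof.
move=> sp; apply: le_trans (directional_le y x sp (lexx 0)) _.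
by rewrite scale0r mul0r addr0 subr0.
Qed.

Lemma directional_sublinear p y : sublinear p -> sublinear (directional p y).
Proof.
move=> sp; split=> [x x'|a x a0].
  rewrite -lerBlDr; apply: directional_ge => t t0.
  rewrite lerBlDl -lerBlDr; apply: directional_ge => u u0.
  rewrite lerBlDr.
  apply: le_trans (directional_le y _ sp (addr_ge0 t0 u0)) _.
  have := sp.1 (x + t *: y) (x' + u *: y).
  by rewrite addrACA -scalerDl; lra.
rewrite -ler_pdivrMl//; apply: directional_ge => t t0.
rewrite ler_pdivrMl//.
apply: le_trans (directional_le y _ sp (mulr_ge0 (ltW a0) t0)) _.
by rewrite -scalerA -scalerDr sublinearZ// mulrBr mulrA.
Qed.

(** Flattening a minimal [p] along [y] cannot decrease it, so
    [p x <= p (x + y) - p y]; with subadditivity this makes [p] additive. *)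
Lemma minimal_sublinear_linear p : sublinear p ->
  (forall q, sublinear q -> (forall x, q x <= p x) -> q = p) ->
  linear (p : V -> F^o).
Proof.
move=> sp pmin.
have pD x y : p (x + y) = p x + p y.
  apply/le_anti; rewrite sp.1 /= -lerBrDr.
  have {1}<- : directional p y = p.
    apply: pmin; first exact: directional_sublinear.
    by move=> z; exact: directional_le_id.
  have := @directional_le p y x 1 sp ler01.
  by rewrite scale1r mul1r.
have pN x : p (- x) = - p x.
  by apply/eqP; rewrite -subr_eq0 opprK addrC -pD subrr sublinear0.
have pZ a x : p (a *: x) = a * p x.
  have [a0|a0|->] := ltgtP a 0.
  - have na : 0 < - a by rewrite oppr_gt0.
    by rewrite -[a in LHS]opprK scaleNr pN (sublinearZ x sp na) mulNr opprK.
  - exact: sublinearZ.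
  - by rewrite scale0r mul0r sublinear0.
by move=> a x y; rewrite pD pZ.
Qed.

(** Zorn's lemma: the pointwise infimum of a chain of sublinear functionals is
    again sublinear, because two members of the chain that serve [x] and [y]
    can be replaced by the smaller of the two, which serves [x + y]. *)
Lemma exists_minimal_sublinear p : sublinear p ->
  exists q, [/\ sublinear q, forall x, q x <= p x &
    forall q', sublinear q' -> (forall x, q' x <= q x) -> q' = q].
Proof.
move=> sp.
pose T := {q : V -> F | sublinear q /\ forall x, q x <= p x}.
pose below (q q' : T) := `[< forall x, proj1_sig q' x <= proj1_sig q x >].
have [| | |A Atot|q qmax] := @Zorn T below.
- by move=> q; apply/asboolP => x; exact: lexx.
- move=> q1 q2 q3 /asboolP h1 /asboolP h2; apply/asboolP => x.
  exact: le_trans (h2 x) (h1 x).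
- move=> [q1 h1] [q2 h2] /asboolP /= l1 /asboolP /= l2.
  apply: eq_exist => /=; apply/funext => x; apply/le_anti.
  by rewrite l1 l2.
- have [[q0 Aq0]|A0] := pselect (A !=set0); last first.
    by exists (exist _ p (conj sp (fun x => lexx (p x)))) => q Aq; case: A0; exists q.
  pose B x := [set proj1_sig q x | q in A].
  have Blb x : has_lbound (B x).
    exists (- p (- x)) => _ [q Aq <-]; case: (proj2_sig q) => sq qp.
    by apply: le_trans (sublinear_geN x sq); rewrite lerN2.
  have Bne x : B x !=set0 by exists (proj1_sig q0 x), q0.
  pose r x := inf (B x).
  have rle q x : A q -> r x <= proj1_sig q x.
    by move=> Aq; apply: ge_inf => //; exists q.
  have rge x c : (forall q, A q -> c <= proj1_sig q x) -> c <= r x.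
    by move=> h; apply: lb_le_inf => // _ [q Aq <-]; exact: h.
  have rP : sublinear r /\ forall x, r x <= p x.
    split; last first.
      by move=> x; apply: le_trans (rle _ x Aq0) _; case: (proj2_sig q0) => _.
    split=> [x y|a x a0].
      rewrite -lerBlDr; apply: (rge) => q1 Aq1.
      rewrite lerBlDl -lerBlDr; apply: (rge) => q2 Aq2.
      rewrite lerBlDr.
      have [/asboolP l|/asboolP l] := Atot _ _ Aq1 Aq2.
        apply: le_trans (rle _ _ Aq2) _.
        apply: le_trans ((proj2_sig q2).1.1 _ _) _.
        by rewrite addrC lerD2l.
      apply: le_trans (rle _ _ Aq1) _.
      apply: le_trans ((proj2_sig q1).1.1 _ _) _.
      by rewrite addrC lerD2r.
    rewrite -ler_pdivrMl//; apply: (rge) => q Aq; rewrite ler_pdivrMl//.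
    by apply: le_trans (rle _ _ Aq) _; exact: (proj2_sig q).1.2.
  by exists (exist _ r rP) => q Aq; apply/asboolP => x /=; exact: rle.
exists (proj1_sig q); split; [exact: (proj2_sig q).1|exact: (proj2_sig q).2|].
move=> q' sq' q'q.
have q'P : sublinear q' /\ forall x, q' x <= p x.
  by split=> // x; apply: le_trans (q'q x) _; exact: (proj2_sig q).2.
have <- : exist _ q' q'P = q by apply: qmax; apply/asboolP.
by [].
Qed.

(** The Hahn-Banach theorem at a point. Take a minimal functional below
    [directional p z], whose value at [- z] is at most [- p z]: linearity then
    forces the value [p z] at [z]. Working with minimal sublinear functionals
    avoids extending partially defined ones. *)
Lemma sublinear_support p z : sublinear p ->
  exists f : V -> F, [/\ linear (f : V -> F^o), forall x, f x <= p x &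
    p z <= f z].
Proof.
move=> sp.
have [f [sf fp fmin]] := exists_minimal_sublinear (directional_sublinear z sp).
have lf := minimal_sublinear_linear sf fmin.
exists f; split=> // [x|]; first exact: le_trans (fp x) (directional_le_id _ _ sp).
have fN : f (- z) = - f z.
  have := lf (-1) z 0; rewrite !sublinear0// !addr0 scaleN1r => ->.
  exact: scaleN1r.
rewrite -lerN2 -fN; apply: le_trans (fp _) _.
apply: le_trans (directional_le z _ sp ler01) _.
by rewrite scale1r addNr sublinear0// mul1r sub0r.
Qed.

End sublinear.

Lemma real_separating_functional (R : realType) (Y : normedModType R) (z : Y) :
  z != 0 -> exists lam : dual Y, lam z != 0.
Proof.
move=> z0.
have sp : sublinear (fun y : Y => `|y|).
  by split=> [x y|a x a0]; [exact: ler_normD|rewrite normrZ gtr0_norm].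
have [f [lf fle fz]] := sublinear_support z sp.
have fB : f \in @bounded_linear R Y R^o.
  apply/mem_set; split=> //; exists 1 => x; rewrite mul1r.
  have fN : f (- x) = - f x.
    have f0 : f 0 = 0.
      have := lf (-1) 0 0; rewrite scaler0 addr0 => ->.
      by rewrite scaleN1r addNr.
    have := lf (-1) x 0; rewrite addr0 scaleN1r f0 addr0 => ->.
    exact: scaleN1r.
  have fxN : - f x <= `|x| by rewrite -fN (le_trans (fle _))// normrN.
  by rewrite ler_norml; apply/andP; split; [rewrite lerNl|exact: fle].
exists (BoundedOp _ fB) => /=.
by rewrite gt_eqF// (lt_le_trans _ fz)// normr_gt0.
Qed.

(** The same space with scalars restricted to the reals; an alias is needed to
    carry the second module structure. *)
Definition realified (R : realType) (V : lmodType R[i]) : Type := V.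

Section realified.
Context {R : realType} {V : lmodType R[i]}.
HB.instance Definition _ := GRing.Zmodule.copy (realified V) V.
Let scale (a : R) (x : realified V) : realified V := (a%:C)%C *: (x : V).
Let scaleA a b x : scale a (scale b x) = scale (a * b) x.
Proof. by rewrite /scale scalerA -rmorphM. Qed.
Let scale1 : left_id 1 scale.
Proof. by move=> x; rewrite /scale rmorph1 scale1r. Qed.
Let scaleDr : right_distributive scale +%R.
Proof. by move=> a x y; rewrite /scale scalerDr. Qed.
Let scaleDl x : {morph scale^~ x : a b / a + b}.
Proof. by move=> a b; rewrite /scale rmorphD scalerDl. Qed.
HB.instance Definition _ := GRing.Zmodule_isLmodule.Build R (realified V)
  scaleA scale1 scaleDr scaleDl.
End realified.

Lemma realified_scaleE (R : realType) (V : lmodType R[i]) (a : R)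
  (x : realified V) : a *: x = ((a%:C)%C *: (x : V)).
Proof. by []. Qed.

(** A complex functional is determined by its real part [f], as
    [x |-> f x - i f (i x)]; the real part is supplied by the real case for
    the norm, regarded as a seminorm with values in [R]. *)
Lemma complex_separating_functional (R : realType) (Y : normedModType R[i])
    (z : Y) : z != 0 -> exists lam : dual Y, lam z != 0.
Proof.
move=> z0.
pose p (y : realified Y) : R := complex.Re `|y : Y|.
have pE (y : Y) : `|y| = (p y)%:C%C by rewrite RRe_real// normr_real.
have sp : sublinear p.
  split=> [x y|a x a0].
    by rewrite -lecR rmorphD/= -!pE; exact: ler_normD.
  rewrite -lecR rmorphM/= -!pE (realified_scaleE a x) normrZ.
  by rewrite ger0_norm// ler0c ltW.
have [f [lf fle fz]] := sublinear_support (z : realified Y) sp.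
have fD (x y : Y) : f (x + y) = f x + f y.
  by have := lf 1 x y; rewrite !scale1r.
have f0 : f 0 = 0.
  by have := fD 0 0; rewrite addr0 => /eqP; rewrite -subr_eq0 opprD addNKr oppr_eq0 => /eqP.
have fZ (a : R) (x : Y) : f ((a%:C)%C *: x) = a * f x.
  by have := lf a x 0; rewrite f0 !addr0.
have fN (x : Y) : f (- x) = - f x.
  by have := fZ (-1) x; rewrite rmorphN rmorph1 scaleN1r mulN1r.
have fnorm (x : Y) : `|f x| <= p x.
  rewrite ler_norml fle andbT lerNl -fN (le_trans (fle _))//.
  by rewrite /p normrN.
pose lam (x : Y) : R[i]^o := (f x +i* (- f ('i%C *: x)))%C.
have lamlin : linear lam.
  move=> [a b] x y; rewrite /lam.
  have fc (u v : R) (w : Y) : f ((u +i* v)%C *: w) = u * f w + v * f ('i%C *: w).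
    have -> : (u +i* v)%C = (u%:C + v%:C * 'i)%C by simpc.
    by rewrite scalerDl fD -scalerA !fZ.
  rewrite scalerDr !fD scalerA.
  have -> : ('i * (a +i* b))%C = ((- b) +i* a)%C by simpc.
  rewrite (fc a b x) (fc (- b) a x).
  have sE (c d : R[i]) : c *: (d : R[i]^o) = c * d by [].
  by rewrite sE; simpc; congr (_ +i* _)%C; ring.
have lamB : lam \in @bounded_linear _ Y R[i]^o.
  apply/mem_set; split=> //; exists 2 => x; rewrite /lam.
  rewrite [X in `|X|]complexE/= (le_trans (ler_normD _ _))// normrM.
  have -> : `|'i%C : R[i]| = 1.
    by rewrite normc_def /= expr0n expr1n add0r sqrtr1.
  rewrite mul1r mulr2n mulrDl mul1r.
  have H u : `|(u%:C)%C| = (`|u|%:C)%C :> R[i].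
    by rewrite normc_def /= expr0n addr0 sqrtr_sqr.
  rewrite !H lerD// ?pE ?lecR// normrN (le_trans (fnorm _))//.
  rewrite -lecR -!pE normrZ.
  by rewrite normc_def /= expr0n expr1n add0r sqrtr1 mul1r.
exists (BoundedOp _ lamB) => /=; rewrite /lam eq_complex negb_and /=.
by rewrite gt_eqF// (lt_le_trans _ fz)// -ltcR -pE normr_gt0.
Qed.

Lemma separating_functional (R : realType) (s : scalars)
    (Y : normedModType (scalar_field R s)) (z : Y) :
  z != 0 -> exists lam : dual Y, lam z = 1.
Proof.
move=> z0; have [lam lamz] : exists lam : dual Y, lam z != 0.
  case: s Y z z0 => Y z z0; first exact: real_separating_functional.
  exact: complex_separating_functional.
exists ((lam z)^-1 *: lam); change ((lam z)^-1 * lam z = 1).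
by rewrite mulVf.
Qed.

Lemma half_pow_le (K : numFieldType) i j : (i <= j)%N -> 2 ^- j <= 2 ^- i :> K.
Proof.
by move=> ij; rewrite lef_pV2 ?posrE ?exprn_gt0// ler_eXn2l// ltr1n.
Qed.

Lemma half_pow_lt (R : realType) (s : scalars) (e : scalar_field R s) :
  0 < e -> exists k, 2 ^- k < e.
Proof.
have real_case (d : R) : 0 < d -> exists k, 2 ^- k < d.
  move=> d0; exists (Num.truncn d^-1).
  rewrite invf_plt ?posrE ?exprn_gt0//.
  have := truncnS_gt d^-1; move/lt_le_trans; apply.
  by rewrite -natrX ler_nat ltn_expl.
case: s e => /= e; first exact: real_case.
rewrite ltcE => /andP[/eqP im0 /real_case[k kd]]; exists k.
have -> : e = (complex.Re e)%:C%C by case: e im0 kd => a b /= ->.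
by rewrite -(rmorph_nat (real_complex R)) -rmorphXn -fmorphV ltcR.
Qed.

(** * The Banach space of bounded operators and its compact elements *)

Section operators.
Context {R : realType} {s : scalars}.
Local Notation K := (scalar_field R s).

Lemma op_norm_ball {X Y : normedModType K} (S S' : bounded_op X Y) (e : K) x :
  `|S - S'| < e -> `|S x - S' x| <= e * `|x|.
Proof.
move=> h; apply: le_trans (op_normP (S - S') x) _.
by rewrite ler_wpM2r// ltW.
Qed.

(** A Cauchy filter of operators is pointwise Cauchy; its pointwise limit obeys
    the same uniform estimates, hence is bounded and is the norm limit. *)
Lemma bounded_op_complete {X : normedModType K} {Y : completeNormedModType K}
    (F : set_system (bounded_op X Y)) : ProperFilter F -> cauchy F -> cvg F.
Proof.
move=> FF /cauchyP Fc.
have Fd d : 0 < d -> exists S0, \forall S \near F, `|S0 - S| < d.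
  by move=> /Fc[S0 H]; exists S0; rewrite -ball_normE in H.
have ex x : exists l : Y, (fun S : bounded_op X Y => S x) @ F --> l.
  suff H : cvg ((fun S : bounded_op X Y => S x) @ F) by exact: (cvg_ex _).1 H.
  apply/cauchy_cvgP; apply/cauchy_exP => e e0.
  have x0 : 0 < `|x| + 1 by rewrite ltr_wpDl.
  have [S0 FS0] := Fd (e / (`|x| + 1)) (divr_gt0 e0 x0).
  exists (S0 x); rewrite -ball_normE; apply: filterS FS0 => S /= SS0.
  apply: le_lt_trans (op_norm_ball x SS0) _.
  by rewrite mulrAC ltr_pdivrMr// ltr_pM2l// ltrDl.
pose L x := sval (cid (ex x)).
have LP x : (fun S : bounded_op X Y => S x) @ F --> L x by exact: svalP (cid (ex x)).
have Lnear S0 d : (\forall S \near F, `|S0 - S| < d) ->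
    forall x, `|S0 x - L x| <= d * `|x|.
  move=> FS0 x; apply/ler_addgt0Pr => e e0.
  have /cvgr_distC_lt /(_ e e0) Fx := LP x.
  near F => S.
  rewrite -(subrKA (S x)) (le_trans (ler_normD _ _))// lerD//.
    by apply: op_norm_ball; near: S.
  by apply: ltW; near: S.
have Llin : linear L.
  move=> c u v; apply: (@cvg_unique _ (@norm_hausdorff _ Y)
    ((fun S : bounded_op X Y => S (c *: u + v)) @ F)); first exact: LP.
  rewrite (_ : (fun _ => _) = (fun S : bounded_op X Y => c *: S u + S v)).
    by apply: cvgD; [apply: cvgZr|]; exact: LP.
  by apply/funext => S; rewrite linearP.
have LB : L \in bounded_linear.
  apply/mem_set; split=> //.
  have [S0 FS0] := Fd 1 ltr01; have [M M0 SM] := bop_bounded S0.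
  exists (1 + M) => x; rewrite mulrDl -(subrK (S0 x) (L x)).
  by rewrite (le_trans (ler_normD _ _))// lerD// distrC; exact: Lnear.
apply/cvg_ex; exists (BoundedOp _ LB); apply/cvgrPdist_le => e e0.
have e20 : 0 < e / 2 by rewrite divr_gt0.
have [S0 FS0] := Fd _ e20; apply: filterS (FS0) => S SS0.
apply: op_norm_lub => x x1.
rewrite (_ : _ x = (L x - S0 x) + (S0 x - S x)); last by rewrite subrKA.
rewrite (le_trans (ler_normD _ _))// [e]splitr lerD//.
  rewrite distrC (le_trans (Lnear _ _ FS0 x))// ler_piMr// ltW//.
by rewrite (le_trans (op_norm_ball x SS0))// ler_piMr// ltW.
Unshelve. all: by end_near. Qed.

HB.instance Definition _ (X : normedModType K) (Y : completeNormedModType K) :=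
  Uniform_isComplete.Build (bounded_op X Y) (@bounded_op_complete X Y).

(** The analogue of total boundedness with compact sets in place of finite
    ones. An ultrafilter [F] on [A] is Cauchy: the points of the compact [C]
    that are close to a member of [F] have a cluster point [c0], and the
    complement of the ball around [c0] cannot belong to [F]. *)
Lemma near_compacts_compact {Y : completeNormedModType K} (A : set Y) :
  closed A ->
  (forall e : K, 0 < e -> exists2 C : set Y, compact C &
    forall x, A x -> exists2 c, C c & `|x - c| < e) ->
  compact A.
Proof.
move=> Acl Atb; rewrite compact_ultra => F UF FA.
have PF : ProperFilter F by exact: ultra_proper.
have : cvg F.
  apply/cauchy_cvgP; apply/cauchy_exP => e e0.
  have e20 : 0 < e / 2 by rewrite divr_gt0.
  have [C Cc AC] := Atb _ e20.
  (* The trace on [C] of the neighbourhoods of the members of [F]. *)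
  pose G := filter_from F (fun B => [set c | C c /\ exists2 x, B x & `|x - c| < e / 2]).
  have FG : Filter G.
    apply: filter_from_filter; first by exists A.
    move=> B1 B2 F1 F2; exists (B1 `&` B2); first exact: filterI.
    by move=> c [Cc' [x [B1x B2x] xc]]; split; split=> //; exists x.
  have PG : ProperFilter G.
    apply: filter_from_proper => B FB.
    have [x [Bx Ax]] := filter_ex (filterI FB FA).
    by have [c Cc' xc] := AC _ Ax; exists c; split=> //; exists x.
  have GC : G C by exists A => // c [].
  have [c0 [Cc0 clc0]] := Cc G PG GC.
  exists c0; have [//|FN] := in_ultra_setVsetC (ball c0 e) UF.
  have GN : G [set c | C c /\ exists2 x, (~` ball c0 e) x & `|x - c| < e / 2].
    by exists (~` ball c0 e).
  have [c [[_ [x xN xc]] cc0]] := clc0 _ _ GN (nbhsx_ballx c0 _ e20).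
  case: xN; move: cc0; rewrite -!ball_normE /= => cc0.
  rewrite -(subrKA c) (le_lt_trans (ler_normD _ _))// [e]splitr ltrD//.
  by rewrite distrC.
move=> /cvg_ex[p Fp]; exists p; split=> //.
exact: (closed_cvg (u_ := id) A Acl FA p Fp).
Qed.

Lemma compact_op_closed {X : normedModType K} {Y : completeNormedModType K}
    (S : bounded_op X Y) :
  (forall e : K, 0 < e -> exists2 S' : bounded_op X Y,
     S' \in is_compact_op & `|S - S'| < e) ->
  S \in is_compact_op.
Proof.
move=> h; apply/mem_set; apply: near_compacts_compact; first exact: closed_closure.
move=> e e0; have e20 : 0 < e / 2 by rewrite divr_gt0.
have [S' /compact_opP[C cC S'C] SS'] := h _ e20.
exists C => // y /(_ _ (nbhsx_ballx y _ e20))[_ [[x x1 <-]]].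
rewrite -ball_normE /= => yx.
exists (S' x); first exact: S'C.
rewrite -(subrKA (S x)) (le_lt_trans (ler_normD _ _))// [e]splitr ltr_leD//.
by rewrite (le_trans (op_norm_ball x SS'))// ler_piMr// ltW.
Qed.

(** Over the complex numbers the disc lies in the image of a square. *)
Lemma scalar_ball_compact (M : K) :
  exists2 C : set K, compact C & forall a, `|a| <= M -> C a.
Proof.
case: s M => /= M.
  exists `[- M, M]%classic; first exact: segment_compact.
  by move=> a; rewrite ler_norml /= in_itv.
pose C : numFieldType := R[i].
pose f (z : R * R) : C := (z.1 +i* z.2)%C.
pose I := `[- complex.Re M, complex.Re M]%classic : set R.
exists (f @` (I `*` I)); last first.
  case=> a b; rewrite normc_def lecE /= => /andP[_ h].
  have sq (u v : R) : `|u| <= Num.sqrt (u ^+ 2 + v ^+ 2).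
    by rewrite -sqrtr_sqr ler_wsqrtr// lerDl sqr_ge0.
  exists (a, b) => //; split; rewrite /I /= in_itv /= -ler_norml.
    exact: le_trans (sq a b) h.
  by apply: le_trans (sq b a) _; rewrite addrC.
apply: continuous_compact; last by apply: compact_setX; exact: segment_compact.
apply: continuous_subspaceT => z.
have HC : continuous (fun a : R => (a%:C)%C : C).
  move=> a; apply/cvgrPdist_lt => -[e1 e2]; rewrite ltcE /= => /andP[/eqP-> e10].
  near=> b; rewrite -rmorphB normc_def /= expr0n addr0 sqrtr_sqr.
  by rewrite ltcR; near: b; exact: cvgr_dist_lt.
rewrite (_ : f = fun z => ((z.1)%:C + 'i * (z.2)%:C)%C); last first.
  by apply/funext => w; rewrite /f [LHS]complexE.
apply: cvgD; first by apply: continuous_comp; [exact: cvg_fst|exact: HC].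
by apply: cvgMr; apply: continuous_comp; [exact: cvg_snd|exact: HC].
Unshelve. all: by end_near. Qed.

Lemma rank_one_compact {X Y : normedModType K} (y : Y) (phi : dual X) :
  rank_one y phi \in is_compact_op.
Proof.
apply/compact_opP; have [M M0 phiM] := bop_bounded phi.
have [C cC MC] := scalar_ball_compact M.
exists [set a *: y | a in C].
  apply: continuous_compact => //; apply: continuous_subspaceT.
  exact: scalel_continuous.
move=> x x1; exists (phi x) => //; apply: MC.
by rewrite (le_trans (phiM x))// ler_piMr.
Qed.

End operators.

(** * Spread-out sets of integers of positive lower density *)

Lemma logn_fact_le p n : prime p -> (logn p n`! <= n)%N.
Proof.
move=> pp; rewrite logn_fact// big_add1 /= big_mkord.
suff H K : (\sum_(k < K) n %/ p ^ k.+1 + n %/ p ^ K <= n)%N.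
  by apply: leq_trans (H n); rewrite leq_addr.
elim: K => [|K IH]; first by rewrite big_ord0 divn1.
apply: leq_trans IH; rewrite big_ord_recr /= -addnA leq_add2l expnSr divnMA.
set c := (n %/ p ^ K)%N; apply: leq_trans (leq_divM c p).
by rewrite addnn -muln2 leq_mul2l prime_gt1// orbT.
Qed.

(** An increasing reindexing of the positive integers in which [m] and [n] are
    at least [logn 2 m + logn 2 n] apart, the 2-adic valuation thus prescribing
    how isolated an integer becomes. The valuation of a factorial accumulates
    those of its factors, so that each integer pushes all later ones away. *)
Definition spread m : nat := (logn 2 m.-1`! + logn 2 m`! + 2 * m)%N.

Lemma logn2_factS m : (0 < m)%N -> logn 2 m`! = (logn 2 m + logn 2 m.-1`!)%N.
Proof. by case: m => // m _; rewrite factS lognM// fact_gt0. Qed.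

Lemma logn2_fact_homo : {homo (fun m => logn 2 m`!) : m n / (m <= n)%N}.
Proof.
apply: homo_leq => [//|m|m]; first by move=> ? ?; exact: leq_trans.
by rewrite (logn2_factS (ltn0Sn m)) leq_addl.
Qed.

Lemma spread_gap m n : (0 < m < n)%N ->
  (spread m + (logn 2 m + logn 2 n) < spread n)%N.
Proof.
case/andP=> m0 mn; rewrite /spread.
have n0 : (0 < n)%N by exact: leq_trans mn.
have h1 := logn2_factS m0; have h2 := logn2_factS n0.
have h3 : (logn 2 m`! <= logn 2 n.-1`!)%N.
  by apply: logn2_fact_homo; rewrite -ltnS prednK.
lia.
Qed.

Lemma spread_ltn m n : (0 < m < n)%N -> (spread m < spread n)%N.
Proof. by move=> /spread_gap; lia. Qed.

Lemma spread_inj m n : (0 < m)%N -> (0 < n)%N -> spread m = spread n -> m = n.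
Proof.
move=> m0 n0; case: (ltngtP m n) => // mn.
  have := @spread_ltn m n; rewrite m0 mn => /(_ isT); lia.
have := @spread_ltn n m; rewrite n0 mn => /(_ isT); lia.
Qed.

Lemma spread_ge m : (0 < m)%N -> (logn 2 m + m <= spread m)%N.
Proof. by move=> m0; rewrite /spread (logn2_factS m0); lia. Qed.

Lemma spread_gem m : (m <= spread m)%N.
Proof. by rewrite /spread; lia. Qed.

(** The gaps are prescribed by a valuation that is at most 1 on average, so the
    reindexing only costs a constant factor and preserves positive density. *)
Lemma spread_le m : (spread m <= 4 * m)%N.
Proof.
rewrite /spread.
have := logn_fact_le m (isT : prime 2); have := logn_fact_le m.-1 (isT : prime 2).
lia.
Qed.

Lemma logn2_odd_mul a j : logn 2 (2 ^ a * j.*2.+1) = a.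
Proof.
rewrite lognM ?expn_gt0// pfactorK//.
by rewrite lognE/= dvdn2 /= odd_double /= addn0.
Qed.

(** Counts the [m = 2 ^ a * (2 * j + 1)] with [m <= N / 4], which suffices
    because [spread m <= 4 * m]. *)
Lemma count_spread_ge (q : nat) (q0 : (0 < q)%N) (M : set nat) a N :
  (forall m, (0 < m)%N -> logn 2 m = a -> M (spread m ^ q)%N) ->
  (N %/ 2 ^ a.+3 <= count (fun n => n \in M) (iota 1 (N ^ q)))%N.
Proof.
move=> HM; rewrite -size_filter.
pose m j := (2 ^ a * j.*2.+1)%N.
have m0 j : (0 < m j)%N by rewrite muln_gt0 expn_gt0.
pose s := [seq (spread (m j) ^ q)%N | j <- iota 0 (N %/ 2 ^ a.+3)].
have -> : (N %/ 2 ^ a.+3)%N = size s by rewrite size_map size_iota.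
apply: uniq_leq_size.
  rewrite map_inj_uniq ?iota_uniq// => i j /eqP.
  rewrite eqn_exp2r// => /eqP/(spread_inj (m0 i) (m0 j))/eqP.
  rewrite /m eqn_pmul2l ?expn_gt0// eqSS => /eqP/double_inj //.
move=> _ /mapP[j + ->]; rewrite mem_iota => /andP[_ jN].
rewrite mem_filter mem_set/=; last by apply: HM => //; exact: logn2_odd_mul.
rewrite mem_iota expn_gt0; apply/andP; split.
  by apply/orP; left; apply: leq_trans (spread_gem _).
rewrite add1n ltnS leq_exp2r//; apply: leq_trans (spread_le _) _.
apply: leq_trans (leq_divM N (2 ^ a.+3)).
move: jN; rewrite add0n; set c := (N %/ _)%N => jN.
rewrite /m !expnS; set b := (2 ^ a)%N.
have h : (b * j.*2.+1 <= b * c.*2)%N.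
  by rewrite leq_mul2l (leq_trans (leqnSn _)) ?orbT// -doubleS leq_double.
apply: (@leq_trans (4 * (b * c.*2))%N); first by rewrite leq_mul2l h orbT.
by rewrite -muln2; nia.
Qed.

Lemma q_lower_density_gt0 (R : realType) (q : nat) (q0 : (0 < q)%N)
    (M : set nat) a :
  (forall m, (0 < m)%N -> logn 2 m = a -> M (spread m ^ q)%N) ->
  (0 < @q_lower_density R q M)%E.
Proof.
move=> HM; set b := (2 ^ a.+3)%N.
have b0 : (0 < b)%N by rewrite expn_gt0.
have b20 : 0 < (2 * b)%:R :> R by rewrite ltr0n muln_gt0 b0.
have c0 : 0 < (2 * b)%:R^-1 :> R by rewrite invr_gt0.
apply: (@lt_le_trans _ _ ((2 * b)%:R^-1%:E)%E); first by rewrite lte_fin.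
rewrite /q_lower_density limn_einf_lim.
apply: lime_ge; first exact: is_cvg_einfs.
exists b => // k /= bk; apply: le_ereal_inf_tmp => _ [n /= kn <-].
have bn : (b <= n)%N by exact: leq_trans kn.
rewrite lee_fin ler_pdivlMr ?ltr0n ?(leq_trans b0)//.
apply: (@le_trans _ _ (n %/ b)%:R).
  rewrite mulrC ler_pdivrMr// -natrM ler_nat.
  have := divn_eq n b; have := ltn_pmod n b0; have : (0 < n %/ b)%N by rewrite divn_gt0.
  set c := (n %/ b)%N; nia.
by rewrite ler_nat; exact: count_spread_ge.
Qed.

(** * A criterion for q-frequent hypercyclicity *)

(** Strict monotonicity is used twice below: it makes the levels [N k] distinct,
    and it gives [k <= N k]. *)
Lemma exists_increasing (P : nat -> nat -> Prop) :
  (forall k, exists N, P k N) ->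
  (forall k N N', (N <= N')%N -> P k N -> P k N') ->
  exists N : nat -> nat, (forall k l, (k < l)%N -> (N k < N l)%N) /\ forall k, P k (N k).
Proof.
move=> exP monoP; have [N NP] := choice exP.
pose N' k := (\sum_(i < k.+1) (N i).+1)%N.
exists N'; split=> [k l|k].
  apply: (homo_ltn ltn_trans) => i.
  rewrite /N' [X in (_ < X)%N]big_ord_recr /=. by rewrite addnS ltnS leq_addr.
by apply: monoP (NP k); rewrite /N' big_ord_recr /= ltnW// addnS ltnS leq_addl.
Qed.

Lemma sum_half_pow_le (K : numFieldType) k L :
  \sum_(l < L) 2 ^- (k + l) <= 2 * 2 ^- k :> K.
Proof.
suff -> : \sum_(l < L) 2 ^- (k + l) = 2 * 2 ^- k - 2 * 2 ^- (k + L) :> K.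
  by rewrite lerBlDr lerDl mulr_ge0 ?invr_ge0 ?exprn_ge0.
elim: L => [|L IH]; first by rewrite big_ord0 addn0 subrr.
rewrite big_ord_recr /= IH addnS exprS; field.
by rewrite !expf_neq0 ?pnatr_eq0.
Qed.

Section criterion.
Context {R : realType} {s : scalars}.
Local Notation K := (scalar_field R s).

Lemma iter_bounded_linear {E : normedModType K} (A : bounded_op E E) n :
  iter n A \in @bounded_linear K E E.
Proof.
elim: n => [|n IH].
  by apply/mem_set; split=> //; exists 1 => x; rewrite mul1r.
exact: (comp_op_subproof A (BoundedOp _ IH)).
Qed.

(** Cauchy's condition for unconditional convergence at precision [d], with the
    finite index set given as a duplicate-free list, the form in which sums over
    index sets are reindexed below. *)
Definition small_sums {E : normedModType K} (x : nat -> nat -> E) (d : K) N :=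
  forall (G : seq nat) r, uniq G -> (forall n, n \in G -> (N <= n)%N) ->
  `|\sum_(n <- G) x n r| < d.

Lemma unconditional_small_sums {E : normedModType K} (x : nat -> nat -> E) d :
  unconditionally_cvg_uniformly x -> 0 < d -> exists N, small_sums x d N.
Proof.
move=> ux d0; have [N _ HN] := ux d d0; exists N => G r uG GN.
pose G' := [fset n in G]%fset.
rewrite (perm_big G') /=; last first.
  by apply: uniq_perm => // n; rewrite inE.
by apply: HN => n; rewrite inE; exact: GN.
Qed.

Context {E : completeNormedModType K} (A : bounded_op E E).
Variables (q : nat) (q_gt0 : (0 < q)%N).

Section fixed_scale.
Variables (w : nat -> E) (sigma : nat -> nat -> E).
Hypothesis hb1 : forall k n, iter (n ^ q)%N A (sigma k (n ^ q)%N) = w k.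
Hypothesis hb2 : forall k m n, (n < m)%N ->
  iter (n ^ q)%N A (sigma k (m ^ q)%N) = sigma k (m ^ q - n ^ q)%N.

(** The two families of series, whose terms are at distance [n] from the time [r]:
   [past] describes at time [r ^ q] what was planted before, [future] what is
   planted for later. *)
Let past l (n r : nat) : E :=
  if (n <= r)%N then iter (r ^ q - (r - n) ^ q)%N A (w l) else 0.
Let future l (n r : nat) : E := sigma l ((n + r) ^ q - r ^ q)%N.

Variable N : nat -> nat.
Hypothesis N_incr : forall k l, (k < l)%N -> (N k < N l)%N.
Hypothesis N_past : forall k l, (l <= k)%N ->
  small_sums (past l) (2 ^- (k + k)) (N k).
Hypothesis N_future : forall k l, (l <= k)%N ->
  small_sums (future l) (2 ^- (k + k)) (N k).

Let N_inj : injective N.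
Proof.
move=> k l Nkl; case: (ltngtP k l) => // /N_incr; rewrite Nkl ltnn//.
Qed.

Let N_ge k : (k <= N k)%N.
Proof. by elim: k => // k IH; apply: leq_ltn_trans IH (N_incr _). Qed.

(** The level [N (maxn k l)] is adapted to both families with index [l], and it
   bounds their tails by [2 ^- (2 * maxn k l)], hence by [2 ^- (k + l)]. The
   smallness in both [k] and [l] makes the sum over [l] small with [k]. *)
Let block_small (f : nat -> nat -> nat -> E) k l (G : seq nat) (h : nat -> nat)
    (g : nat -> E) r :
  (forall k l, (l <= k)%N -> small_sums (f l) (2 ^- (k + k)) (N k)) ->
  uniq G -> {in G &, injective h} ->
  (forall m, m \in G -> (N k + N l <= h m)%N) ->
  (forall m, m \in G -> g m = f l (h m) r) ->
  `|\sum_(m <- G) g m| <= 2 ^- (k + l).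
Proof.
move=> Nf uG hinj hN gE.
rewrite (eq_big_seq (fun m => f l (h m) r))// -(big_map h xpredT (f l ^~ r)).
have uhG : uniq (map h G) by rewrite map_inj_in_uniq.
have [lk|kl] := leqP l k.
  apply: (@le_trans _ _ (2 ^- (k + k))); last by rewrite half_pow_le// leq_add2l.
  apply/ltW/Nf => // _ /mapP[m mG ->].
  by apply: leq_trans (hN _ mG); rewrite leq_addr.
apply: (@le_trans _ _ (2 ^- (l + l))); last by rewrite half_pow_le// leq_add2r ltnW.
apply/ltW/(Nf l) => // _ /mapP[m mG ->].
by apply: leq_trans (hN _ mG); rewrite leq_addl.
Qed.

Let blocks_small k (G : nat -> E) L :
  (forall l, `|G l| <= 2 ^- (k + l)) -> `|\sum_(l < L) G l| <= 2 * 2 ^- k.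
Proof.
move=> HG; apply: le_trans (sum_half_pow_le _ k L).
by apply: le_trans (ler_norm_sum _ _ _) _; apply: ler_sum.
Qed.

Let active l m := (0 < m)%N && (logn 2 m == N l).

Let active_lt l m : active l m -> (l < m)%N.
Proof.
move=> /andP[m0 /eqP lm]; apply: leq_ltn_trans (N_ge l) _.
by rewrite -lm ltn_logl.
Qed.

(** The integers [m] of valuation [N l] carry the preimages of [w l]. The bound
   [L] is kept apart from [M] so that partial sums can be subtracted. *)
Let orbit_sum L M : E :=
  \sum_(l < L) \sum_(0 <= m < M | active l m) sigma l (spread m ^ q)%N.

Let orbit_sumE L M : (M <= L)%N -> orbit_sum L M = orbit_sum M M.
Proof.
move=> ML; rewrite /orbit_sum -(subnKC ML) big_split_ord /=.
rewrite [X in _ + X]big1 ?addr0// => l _.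
rewrite big_nat_cond big_pred0// => m.
apply/negP => /andP[/andP[_ mM]] /active_lt /= lm.
by have := leq_trans lm (ltnW mM); rewrite ltnNge leq_addr.
Qed.

Let orbit_sum_cauchy k M M' : (N k <= M)%N -> (M <= M')%N ->
  `|orbit_sum M' M' - orbit_sum M M| <= 2 * 2 ^- k.
Proof.
move=> NM MM'; rewrite -(orbit_sumE MM') /orbit_sum -sumrB.
pose G l := [seq m <- index_iota M M' | active l m].
pose g l m : E := sigma l (spread m ^ q)%N.
rewrite (eq_bigr (fun l : 'I_M' => \sum_(m <- G l) g l m)); last first.
  by move=> l _; rewrite (big_cat_nat (n := M))//= addrAC subrr add0r -big_filter.
apply: (blocks_small (G := fun l => \sum_(m <- G l) g l m)) => l.
apply: (block_small (f := future) (h := spread) (r := 0)) => //.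
- by rewrite filter_uniq// iota_uniq.
- move=> m m'; rewrite !mem_filter => /andP[/andP[m0 _] _] /andP[/andP[m'0 _] _].
  exact: spread_inj.
- move=> m; rewrite mem_filter mem_index_iota => /andP[/andP[m0 /eqP lm] /andP[Mm _]].
  apply: leq_trans (spread_ge m0); rewrite lm addnC leq_add2l.
  exact: leq_trans Mm.
- by move=> m _; rewrite /future addn0 exp0n// subn0.
Qed.

(** At the time [n = spread m0] the term [m0] contributes exactly [w k]. The terms
   before it form sums of [past] and those after it sums of [future], in both
   cases at distances at least [N k + N l] from [n]. *)
Let orbit_sum_return k m0 M : active k m0 -> (m0 < M)%N ->
  `|iter (spread m0 ^ q)%N A (orbit_sum M M) - w k| <= 4 * 2 ^- k.
Proof.
move=> km0 m0M; set n := spread m0.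
pose B := BoundedOp _ (iter_bounded_linear A (n ^ q)%N).
have BE x : iter (n ^ q)%N A x = B x by [].
have m0_gt0 : (0 < m0)%N by case/andP: km0.
have lm0 : logn 2 m0 = N k by case/andP: km0 => _ /eqP.
pose g l m := B (sigma l (spread m ^ q)%N).
pose Gp l := [seq m <- index_iota 0 m0 | active l m].
pose Gf l := [seq m <- index_iota m0.+1 M | active l m].
have kM : (k < M)%N by apply: ltn_trans m0M; exact: active_lt.
have -> : iter (n ^ q)%N A (orbit_sum M M) - w k =
    \sum_(l < M) \sum_(m <- Gp l) g l m + \sum_(l < M) \sum_(m <- Gf l) g l m.
  rewrite BE /orbit_sum linear_sum.
  have -> : w k = \sum_(l < M) (if l == Ordinal kM then w k else 0).
    by rewrite -big_mkcond big_pred1_eq.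
  rewrite -sumrB -big_split; apply: eq_bigr => l _.
  rewrite [X in X - _]linear_sum (big_cat_nat (n := m0)) ?(ltnW m0M)//.
  rewrite !big_filter -addrA; congr (_ + _).
  rewrite big_ltn_cond//; have [al|nal] := boolP (active l m0).
    have lk : l = Ordinal kM.
      apply: val_inj; apply: N_inj => /=.
      by case/andP: al => _ /eqP <-; rewrite lm0.
    rewrite lk eqxx /= addrAC [X in X - _](hb1 k n) subrr add0r//.
  rewrite ifN ?subr0//; apply: contraNneq nal => ->.
  by rewrite /active m0_gt0 lm0 /=.
have -> : 4 * 2 ^- k = 2 * 2 ^- k + 2 * 2 ^- k :> K by ring.
rewrite (le_trans (ler_normD _ _))// lerD//.
  apply: (blocks_small (G := fun l => \sum_(m <- Gp l) g l m)) => l.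
  apply: (block_small (f := past) (h := fun m => (n - spread m)%N) (r := n)) => //.
  - by rewrite filter_uniq// iota_uniq.
  - move=> m m'; rewrite !mem_filter !mem_index_iota.
    move=> /andP[/andP[m_gt0 _] mm0] /andP[/andP[m'_gt0 _] m'm0] nmm'.
    have ltm : (spread m < n)%N by apply: spread_ltn; rewrite m_gt0.
    have ltm' : (spread m' < n)%N by apply: spread_ltn; rewrite m'_gt0.
    by apply: spread_inj => //; lia.
  - move=> m; rewrite mem_filter mem_index_iota => /andP[/andP[m_gt0 /eqP lm] mm0].
    have := @spread_gap m m0; rewrite m_gt0 mm0 lm lm0 -/n => /(_ isT); lia.
  - move=> m; rewrite mem_filter mem_index_iota => /andP[/andP[m_gt0 _] mm0].
    have ltm : (spread m < n)%N by apply: spread_ltn; rewrite m_gt0.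
    rewrite /past leq_subr subKn ?(ltnW ltm)// /g /= -{1}(@subnK (spread m ^ q) (n ^ q)).
      by rewrite iterD hb1.
    by rewrite leq_exp2r// ltnW.
apply: (blocks_small (G := fun l => \sum_(m <- Gf l) g l m)) => l.
apply: (block_small (f := future) (h := fun m => (spread m - n)%N) (r := n)) => //.
- by rewrite filter_uniq// iota_uniq.
- move=> m m'; rewrite !mem_filter !mem_index_iota.
  move=> /andP[/andP[m_gt0 _] /andP[mm0 _]] /andP[/andP[m'_gt0 _] /andP[m'm0 _]] nmm'.
  have ltm : (n < spread m)%N by apply: spread_ltn; rewrite m0_gt0.
  have ltm' : (n < spread m')%N by apply: spread_ltn; rewrite m0_gt0.
  by apply: spread_inj => //; lia.
- move=> m; rewrite mem_filter mem_index_iota => /andP[/andP[m_gt0 /eqP lm] /andP[mm0 _]].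
  have := @spread_gap m0 m; rewrite m0_gt0 mm0 lm lm0 -/n => /(_ isT); lia.
- move=> m; rewrite mem_filter mem_index_iota => /andP[/andP[m_gt0 _] /andP[mm0 _]].
  have ltm : (n < spread m)%N by apply: spread_ltn; rewrite m0_gt0.
  by rewrite /future subnK ?(ltnW ltm)// /g /= hb2.
Qed.

(** The bound at the return times passes to the limit; its constant is 2 for
    the past, 2 for the future and 1 for the distance to a partial sum. *)
Lemma orbit_sum_limit : exists x : E,
  (forall P : set E, closed P -> P 0 -> (forall u v, P u -> P v -> P (u + v)) ->
     (forall k n, P (sigma k n)) -> P x) /\
  forall k m, (0 < m)%N -> logn 2 m = N k ->
    `|iter (spread m ^ q)%N A x - w k| < 5 * 2 ^- k.
Proof.
pose u M := orbit_sum M M.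
have : cvg (u @ \oo).
  apply/cauchy_cvgP; apply/cauchy_exP => e e0.
  have [k ke] := half_pow_lt (divr_gt0 e0 (ltr0n K 2)).
  exists (u (N k)); exists (N k) => // M /= kM.
  rewrite -ball_normE /= distrC; apply: le_lt_trans (orbit_sum_cauchy (leqnn _) kM) _.
  by rewrite mulrC -ltr_pdivlMr.
move=> /cvg_ex[x ux]; exists x; split.
  move=> P Pcl P0 PD Psig; apply: (closed_cvg P Pcl _ x ux).
  near=> M; rewrite /u /orbit_sum; apply: big_ind => // l _.
  by apply: big_ind.
move=> k m m0 mk; set n := (spread m ^ q)%N.
pose B := BoundedOp _ (iter_bounded_linear A n).
have [C C0 BC] := bop_bounded B.
have C1 : 0 < C + 1 by rewrite ltr_wpDl.
have k0 : 0 < 2 ^- k :> K by rewrite invr_gt0 exprn_gt0.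
have /cvgrPdist_lt/(_ _ (divr_gt0 k0 C1)) unear := ux.
near \oo => M.
have mM : (m < M)%N by near: M; exact: nbhs_infty_gt.
have am : active k m by rewrite /active m0 mk /=.
rewrite -(subrKA (B (u M))) (le_lt_trans (ler_normD _ _))//.
have -> : 5 * 2 ^- k = 2 ^- k + 4 * 2 ^- k :> K by ring.
apply: ltr_leD; last exact: orbit_sum_return.
change (`|B x - B (u M)| < 2 ^- k); rewrite -linearB.
apply: le_lt_trans (BC _) _.
apply: (@le_lt_trans _ _ (C * (2 ^- k / (C + 1)))).
  by rewrite ler_wpM2l// ltW//; near: M.
by rewrite mulrCA gtr_pMr// ltr_pdivrMr// mul1r ltrDl.
Unshelve. all: by end_near. Qed.

End fixed_scale.

(** The targets are repeated, [w (logn 2 k.+1)] being the target of index [k],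
    so that each of them is approached at arbitrarily small scales [2 ^- k].
    The limit lies in the closed additive hull of the vectors [sigma k n]; this
    is how it inherits compactness when the vectors are operators. *)
Theorem q_frequent_hypercyclicity_criterion (w : nat -> E) (sigma : nat -> nat -> E) :
  (forall k, unconditionally_cvg_uniformly (fun n r : nat =>
     if (n <= r)%N then iter (r ^ q - (r - n) ^ q)%N A (w k) else 0)) ->
  (forall k, unconditionally_cvg_uniformly (fun n r : nat =>
     sigma k ((n + r) ^ q - r ^ q)%N)) ->
  (forall k n, iter (n ^ q)%N A (sigma k (n ^ q)%N) = w k) ->
  (forall k m n, (n < m)%N ->
     iter (n ^ q)%N A (sigma k (m ^ q)%N) = sigma k (m ^ q - n ^ q)%N) ->
  exists x : E,
  (forall P : set E, closed P -> P 0 -> (forall u v, P u -> P v -> P (u + v)) ->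
     (forall k n, P (sigma k n)) -> P x) /\
  forall k (e : K), 0 < e ->
    (0 < @q_lower_density R q [set n | (`|iter n A x - w k| < e)%R])%E.
Proof.
move=> hpast hfuture hb1 hb2.
pose d k := logn 2 k.+1.
pose past l (n r : nat) : E :=
  if (n <= r)%N then iter (r ^ q - (r - n) ^ q)%N A (w l) else 0.
pose future l (n r : nat) : E := sigma l ((n + r) ^ q - r ^ q)%N.
have small_le (f : nat -> nat -> E) e M M' : (M <= M')%N ->
    small_sums f e M -> small_sums f e M'.
  by move=> MM' fM G r uG GM'; apply: fM => // n /GM'; exact: leq_trans.
pose good k M := forall l, (l <= k)%N ->
  small_sums (past (d l)) (2 ^- (k + k)) M /\
  small_sums (future (d l)) (2 ^- (k + k)) M.
have [k|k M M' MM' gM l lk|N [Nincr NP]] := @exists_increasing good.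
- have k0 : 0 < 2 ^- (k + k) :> K by rewrite invr_gt0 exprn_gt0.
  have ex l : exists M, small_sums (past (d l)) (2 ^- (k + k)) M /\
      small_sums (future (d l)) (2 ^- (k + k)) M.
    have [M1 H1] := unconditional_small_sums (hpast (d l)) k0.
    have [M2 H2] := unconditional_small_sums (hfuture (d l)) k0.
    exists (maxn M1 M2); split.
      by apply: small_le H1; exact: leq_maxl.
    by apply: small_le H2; exact: leq_maxr.
  have [Ml HMl] := choice ex; exists (\max_(l < k.+1) Ml l) => l lk.
  have lM : (Ml l <= \max_(l < k.+1) Ml l)%N.
    exact: (leq_bigmax (Ordinal (lk : (l < k.+1)%N))).
  by have [H1 H2] := HMl l; split; [apply: small_le H1|apply: small_le H2].
- by have [H1 H2] := gM l lk; split; [apply: small_le H1|apply: small_le H2].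
have [x [xP xret]] := @orbit_sum_limit (w \o d) (sigma \o d)
  (fun k => hb1 (d k)) (fun k => @hb2 (d k)) N Nincr
  (fun k l lk => (NP k l lk).1) (fun k l lk => (NP k l lk).2).
exists x; split.
  by move=> P Pcl P0 PD Psig; apply: xP => // k n; exact: Psig.
move=> k0 e e0; have [j je] := half_pow_lt (divr_gt0 e0 (ltr0n K 5)).
(* An index [k >= j] with [logn 2 k.+1 = k0], for which the target is [w k0]. *)
pose k := (2 ^ k0 * j.*2.+1).-1.
have kS : k.+1 = (2 ^ k0 * j.*2.+1)%N by rewrite /k prednK// muln_gt0 expn_gt0.
have dk : d k = k0 by rewrite /d kS logn2_odd_mul.
have jk : (j <= k)%N.
  rewrite -ltnS kS; apply: (@leq_trans j.*2.+1).
    by rewrite ltnS -addnn leq_addr.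
  by rewrite leq_pmull// expn_gt0.
apply: (@q_lower_density_gt0 R q q_gt0 _ (N k)) => m m0 mN /=.
have := xret k m m0 mN; rewrite /= dk => /lt_le_trans; apply.
rewrite -ler_pdivlMl// mulrC; apply: le_trans (ltW je).
exact: half_pow_le.
Qed.

End criterion.

(** * Approximation by finite sums of operators of rank one *)

Section tensor.
Context {R : realType} {s : scalars}.
Local Notation K := (scalar_field R s).
Context {X Y : normedModType K}.
Implicit Types (C : set X) (D : set Y) (Phi : set (dual X)).

Lemma sum_opE {V W : normedModType K} I (r : seq I) (S : I -> bounded_op V W) x :
  (\sum_(i <- r) S i) x = \sum_(i <- r) S i x.
Proof.
elim: r => [|i r IH]; first by rewrite !big_nil.
by rewrite !big_cons -IH.
Qed.

(** The operator associated with an element of the algebraic tensor product of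
    [W] and the dual of [V]. *)
Definition tensor_sum {V W : normedModType K} (l : seq (W * dual V)) :
  bounded_op V W := \sum_(z <- l) rank_one z.1 z.2.

Lemma tensor_sumE {V W : normedModType K} (l : seq (W * dual V)) x :
  tensor_sum l x = \sum_(z <- l) z.2 x *: z.1.
Proof. by rewrite /tensor_sum sum_opE. Qed.

(** Coordinates of an operator of finite rank are continuous. Subtracting
    [z (x) (lam \o G)], for [z = G x0] and [lam z = 1], leaves an operator with
    values in the range of [G] and in the kernel of [lam], a space spanned by one
    vector less. *)
Lemma finite_rank_tensor_sum (G : bounded_op X Y) : finite_rank G ->
  exists l, G = tensor_sum l.
Proof.
case=> n [b]; elim: n G b => [|n IH] G b Gb.
  exists [::]; apply: val_inj; apply/funext => x /=; rewrite tensor_sumE big_nil.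
  by have [c ->] := Gb x; rewrite big_ord0.
have [[x0 Gx0]|G0] := pselect (exists x0, G x0 != 0); last first.
  exists [::]; apply: val_inj; apply/funext => x /=; rewrite tensor_sumE big_nil.
  by apply/eqP/negPn/negP => Gx; apply: G0; exists x.
have [lam lamG] := separating_functional Gx0.
(* [b i] is the spanning vector to eliminate, by projecting along it. *)
have [i lami] : exists i, lam (b i) != 0.
  apply: contrapT => lam0; have [c Gc] := Gb x0.
  move: lamG; rewrite Gc linear_sum big1 => [/eqP|i _]; first by rewrite eq_sym oner_eq0.
  have [lbi|lbi] := eqVneq (lam (b i)) 0; last by case: lam0; exists i.
  by rewrite linearZ /= lbi scaler0.
pose G1 := G - rank_one (G x0) (comp_op lam G).
have G1E x : G1 x = G (x - lam (G x) *: x0).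
  by rewrite linearB linearZ.
pose b' j := b (lift i j) - (lam (b (lift i j)) / lam (b i)) *: b i.
have [x|l Gl] := IH G1 b'.
  have [c Gc] := Gb (x - lam (G x) *: x0); exists (fun j => c (lift i j)).
  have : lam (G (x - lam (G x) *: x0)) = 0.
    have -> : G (x - lam (G x) *: x0) = G x - lam (G x) *: G x0.
      by rewrite linearB linearZ.
    by rewrite linearB linearZ /= lamG [X in _ - X]mulr1 subrr.
  rewrite G1E Gc linear_sum (bigD1_ord i)//= linearZ /= => lam0.
  rewrite (bigD1_ord i)//=.
  have -> : c i = - \sum_(j < n) c (lift i j) * (lam (b (lift i j)) / lam (b i)).
    apply: (mulIf lami); rewrite mulNr mulr_suml.
    move/eqP: lam0; rewrite addr_eq0 => /eqP lam0; rewrite [LHS]lam0; congr (- _).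
    by apply: eq_bigr => j _; rewrite linearZ -mulrA divfK.
  rewrite scaleNr scaler_suml addrC -sumrB; apply: eq_bigr => j _.
  by rewrite /b' scalerBr scalerA.
exists ((G x0, comp_op lam G) :: l).
by rewrite /tensor_sum big_cons -[X in _ + X]Gl /G1 addrC subrK.
Qed.

(** Every finite set is fixed by some operator of finite rank. If [y] is moved by
    the operator [P] found so far, it is corrected by
    [(y - P y) (x) (lam \o (1 - P))] with [lam (y - P y) = 1], which vanishes
    wherever [P] is already the identity. *)
Lemma interpolation (r : seq X) :
  exists l : seq (X * dual X), forall x, x \in r -> tensor_sum l x = x.
Proof.
elim: r => [|y r [l lr]]; first by exists [::].
have [ly|ly] := eqVneq (y - tensor_sum l y) 0.
  exists l => x; rewrite in_cons => /orP[/eqP->|]; last exact: lr.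
  by move/eqP: ly; rewrite subr_eq0 => /eqP.
have [lam lamy] := separating_functional ly; set z := y - _ in lamy ly.
exists ((z, lam - comp_op lam (tensor_sum l)) :: l) => x xr.
rewrite tensor_sumE big_cons -tensor_sumE.
change ((lam x - lam (tensor_sum l x)) *: z + tensor_sum l x = x).
move: xr; rewrite in_cons => /orP[/eqP->|xr].
  have -> : lam y - lam (tensor_sum l y) = 1 by rewrite -lamy /z linearB.
  by rewrite scale1r subrK.
by rewrite lr// subrr scale0r add0r.
Qed.

Lemma comp_op_tensor_sum {Z : normedModType K} (S : bounded_op X Y)
    (l : seq (X * dual Z)) :
  comp_op S (tensor_sum l) = tensor_sum [seq (S z.1, z.2) | z <- l].
Proof.
apply: val_inj; apply/funext => x /=; rewrite !tensor_sumE big_map linear_sum.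
by apply: eq_bigr => z _; rewrite linearZ.
Qed.

Definition tensors (D : set Y) (Phi : set (dual X)) : set (bounded_op X Y) :=
  [set v | exists l : seq (Y * dual X),
    (forall z, z \in l -> D z.1 /\ Phi z.2) /\ v = tensor_sum l].

(** The strong, compact-open and norm topologies differ only in the sets [C] on
    which approximation is required: finite, compact, or the unit ball. *)
Definition approx_on (C : set X) (V : set (bounded_op X Y)) (S : bounded_op X Y) :=
  forall e : K, 0 < e -> exists2 v, V v & forall x, C x -> `|S x - v x| < e.

Lemma approx_onD C D Phi S1 S2 : approx_on C (tensors D Phi) S1 ->
  approx_on C (tensors D Phi) S2 -> approx_on C (tensors D Phi) (S1 + S2).
Proof.
move=> h1 h2 e e0; have e20 : 0 < e / 2 by rewrite divr_gt0.
have [_ [l1 [l1P ->]] H1] := h1 _ e20; have [_ [l2 [l2P ->]] H2] := h2 _ e20.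
exists (tensor_sum (l1 ++ l2)).
  by exists (l1 ++ l2); split=> // z; rewrite mem_cat => /orP[/l1P|/l2P].
move=> x Cx; rewrite /tensor_sum big_cat /=.
rewrite (_ : _ - _ = (S1 x - tensor_sum l1 x) + (S2 x - tensor_sum l2 x)).
  by rewrite (le_lt_trans (ler_normD _ _))// [e]splitr ltrD// ?H1 ?H2.
rewrite addrACA -opprD; reflexivity.
Qed.

Lemma scaled_lt (e c u v : K) : 0 < e -> 0 <= u -> 0 <= v ->
  u <= e / (c + 1) -> v <= c -> u * v < e.
Proof.
move=> e0 u0 v0 ue vc; have c0 : 0 <= c := le_trans v0 vc.
have c1 : 0 < c + 1 by rewrite ltr_wpDl.
apply: (@le_lt_trans _ _ (e / (c + 1) * c)); first exact: ler_pM.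
by rewrite mulrAC ltr_pdivrMr// ltr_pM2l// ltrDl.
Qed.

(** The functional is approximated first, since the precision required of the
    vector depends on the size on [C] of the functional [phi] that is chosen. *)
Lemma approx_on_rank_one C D Phi (b : Y) (psi : dual X) M :
  (forall x, C x -> `|x| <= M) ->
  (forall y (e : K), 0 < e -> exists2 d, D d & `|y - d| < e) ->
  (forall e : K, 0 < e -> exists2 phi, Phi phi &
     forall x, C x -> `|psi x - phi x| < e) ->
  approx_on C (tensors D Phi) (rank_one b psi).
Proof.
move=> CM Dd Phid e e0; have e20 : 0 < e / 2 by rewrite divr_gt0.
have b0 : 0 < `|b| + 1 by rewrite ltr_wpDl.
have [phi Phiphi psiphi] := Phid _ (divr_gt0 e20 b0).
have [N N0 phiN] := bop_bounded phi.
have NM0 : 0 < N * `|M| + 1 by rewrite ltr_wpDl// mulr_ge0.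
have [d Dd' bd] := Dd b _ (divr_gt0 e20 NM0).
exists (tensor_sum [:: (d, phi)]).
  by exists [:: (d, phi)]; split=> // z; rewrite inE => /eqP->.
move=> x Cx; rewrite tensor_sumE big_seq1 /=.
have -> : psi x *: b - phi x *: d = (psi x - phi x) *: b + phi x *: (b - d).
  by rewrite scalerBl scalerBr subrKA.
rewrite (le_lt_trans (ler_normD _ _))// !normrZ [e]splitr ltrD//.
  apply: (@scaled_lt _ `|b|) => //.
  by apply: ltW; apply: psiphi.
rewrite mulrC; apply: (@scaled_lt _ (N * `|M|)) => //; first exact: ltW.
have xM := CM _ Cx; rewrite (le_trans (phiN x))// ler_wpM2l// ger0_norm//.
exact: le_trans xM.
Qed.

Lemma approx_on_tensor_sum C D Phi (l : seq (Y * dual X)) M :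
  (forall x, C x -> `|x| <= M) ->
  (forall y (e : K), 0 < e -> exists2 d, D d & `|y - d| < e) ->
  (forall (psi : dual X) (e : K), 0 < e -> exists2 phi, Phi phi &
     forall x, C x -> `|psi x - phi x| < e) ->
  approx_on C (tensors D Phi) (tensor_sum l).
Proof.
move=> CM Dd Phid; elim: l => [|z l IH].
  move=> e e0; exists (tensor_sum [::]); first by exists [::]; split.
  by move=> x Cx; rewrite subrr normr0.
rewrite /tensor_sum big_cons; apply: approx_onD => //.
by apply: (@approx_on_rank_one _ _ _ _ _ M) => //; exact: Phid.
Qed.

(** On a finite set [S] agrees with [S \o P] for an interpolating [P]. *)
Lemma approx_on_finite D Phi (r : seq X) (S : bounded_op X Y) :
  (forall y (e : K), 0 < e -> exists2 d, D d & `|y - d| < e) ->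
  (forall (psi : dual X) (e : K), 0 < e -> exists2 phi, Phi phi &
     forall x, x \in r -> `|psi x - phi x| < e) ->
  approx_on [set` r] (tensors D Phi) S.
Proof.
move=> Dd Phid; have [l lr] := interpolation r.
have rM x : x \in r -> `|x| <= \sum_(y <- r) `|y|.
  by move=> xr; rewrite (big_rem x)//= lerDl sumr_ge0.
move=> e e0.
have [v vP vS] := approx_on_tensor_sum [seq (S z.1, z.2) | z <- l] rM Dd Phid e0.
exists v => // x /= xr; have := vS x xr.
by rewrite -comp_op_tensor_sum /= lr.
Qed.

(** [S] is close on [C] to [G \o S], where [G] has finite rank and is close to
    the identity on a compact set containing the image of [C]. *)
Lemma approx_on_approximation_property D Phi (C : set X) (S : bounded_op X Y) M :
  approximation_property Y ->
  (forall x, C x -> `|x| <= M) ->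
  (exists2 C', compact C' & forall x, C x -> C' (S x)) ->
  (forall y (e : K), 0 < e -> exists2 d, D d & `|y - d| < e) ->
  (forall (psi : dual X) (e : K), 0 < e -> exists2 phi, Phi phi & `|psi - phi| < e) ->
  approx_on C (tensors D Phi) S.
Proof.
move=> AP CM [C' cC' SC'] Dd Phid e e0; have e20 : 0 < e / 2 by rewrite divr_gt0.
have [G [[n [b Gb]] GC']] := AP C' _ cC' e20.
have [l Gl] : exists l, comp_op G S = tensor_sum l.
  by apply: finite_rank_tensor_sum; exists n, b => x; exact: Gb.
have Phid' (psi : dual X) (d : K) : 0 < d -> exists2 phi, Phi phi &
     forall x, C x -> `|psi x - phi x| < d.
  move=> d0; have M1 : 0 < `|M| + 1 by rewrite ltr_wpDl.
  have [phi Phiphi psiphi] := Phid psi _ (divr_gt0 d0 M1); exists phi => // x Cx.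
  have xM := CM _ Cx.
  apply: le_lt_trans (op_normP (psi - phi) x) _.
  apply: (@scaled_lt _ `|M|) => //; first exact: op_norm_ge0.
    exact: ltW.
  by rewrite ger0_norm//; exact: le_trans xM.
have [v vP vS] := approx_on_tensor_sum l CM Dd Phid' e20.
exists v => // x Cx; rewrite -(subrKA (G (S x))).
rewrite (le_lt_trans (ler_normD _ _))// [e]splitr ltrD//.
  by rewrite distrC; apply: GC'; exact: SC'.
by have := vS x Cx; rewrite -Gl.
Qed.

End tensor.

(** * Neighbourhoods and continuity for the operator topologies *)

Section operator_topologies.
Context {R : realType} {s : scalars}.
Local Notation K := (scalar_field R s).
Context {X Y : normedModType K}.
Implicit Types (C : set X).

Definition close_on C (e : K) (f g : X -> Y) := forall x, C x -> `|f x - g x| < e.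

(** The neighbourhood filter of [f] for uniform convergence on the members of
    [fam]. With powers of 1/2 as precisions, two of them always have a minimum,
    although the order of the scalars is partial. *)
Definition close_filter (fam : set (set X)) (f : X -> Y) : set_system (X -> Y) :=
  filter_from [set p : set X * nat | fam p.1]
              (fun p => [set g | close_on p.1 (2 ^- p.2) f g]).

Lemma close_filter_filter (fam : set (set X)) (f : X -> Y) :
  fam set0 -> setU_closed fam -> Filter (close_filter fam f).
Proof.
move=> fam0 famU; apply: filter_from_filter; first by exists (set0, 0).
move=> [A i] [B j] /= famA famB; exists (A `|` B, maxn i j); first exact: famU.
move=> g /= fg; split=> x /= Ax.
  by apply: lt_le_trans (fg x _) (half_pow_le _ (leq_maxl i j)); left.
by apply: lt_le_trans (fg x _) (half_pow_le _ (leq_maxr i j)); right.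
Qed.

Lemma close_filterP (fam : set (set X)) (f : X -> Y) A e :
  fam A -> 0 < e -> close_filter fam f [set g | close_on A e f g].
Proof.
move=> famA /half_pow_lt[k ke]; exists (A, k) => // g fg x Ax.
exact: lt_trans (fg x Ax) ke.
Qed.

Lemma close_filter_basis (fam : set (set X)) (f : X -> Y) U :
  close_filter fam f U ->
  exists C (e : K), [/\ fam C, 0 < e & forall g, close_on C e f g -> U g].
Proof.
move=> [[C k] /= famC CU]; by exists C, (2 ^- k); split.
Qed.

(** The filter of basic neighbourhoods converges to [S], so it contains every
    neighbourhood of [S]. *)
Lemma sot_nbhs_basis (S : bounded_op X Y) (U : set (bounded_op X Y)) :
  nbhs (S : sot_op X Y) U ->
  exists C (e : K), [/\ finite_set C, 0 < e &
    forall S' : bounded_op X Y, close_on C e S S' -> U S'].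
Proof.
rewrite nbhsE; move=> [W [[V Vop <-] VS] WU].
have Vn : nbhs (bop_fun S : {ptws X -> Y}) V by exact: open_nbhs_nbhs.
have FF : Filter (close_filter finite_set S).
  apply: close_filter_filter; first exact: finite_set0.
  by move=> A B; rewrite finite_setU.
have : {ptws, close_filter finite_set S --> bop_fun S}.
  apply/pointwise_cvgP => t; apply/cvgrPdist_lt => e e0.
  have := close_filterP S (finite_set1 t) e0.
  by apply: filterS => g /= /(_ t erefl).
move=> /(_ V Vn)/close_filter_basis[C [e [Cfin e0 CV]]].
by exists C, e; split=> // S' SS'; apply: WU; exact: CV.
Qed.

Lemma cot_nbhs_basis (S : bounded_op X Y) (U : set (bounded_op X Y)) :
  nbhs (S : cot_op X Y) U ->
  exists C (e : K), [/\ compact C, 0 < e &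
    forall S' : bounded_op X Y, close_on C e S S' -> U S'].
Proof.
rewrite nbhsE; move=> [W [[V Vop <-] VS] WU].
have Vn : nbhs (bop_fun S : {family compact, X -> Y}) V by exact: open_nbhs_nbhs.
have FF : Filter (close_filter compact S).
  by apply: close_filter_filter; [exact: compact0|exact: compactU].
have : {family compact, close_filter compact S --> bop_fun S}.
  apply/fam_cvgP => A cA Q /uniform_nbhs[E [entE EQ]].
  apply: filterS EQ _; move: entE; rewrite -entourage_ballE; move=> [e /= e0 eE].
  apply: filterS (close_filterP S cA e0) => g fg y Ay.
  by apply: eE; rewrite /= -ball_normE; exact: fg.
move=> /(_ V Vn)/close_filter_basis[C [e [Cfin e0 CV]]].
by exists C, e; split=> // S' SS'; apply: WU; exact: CV.
Qed.

Lemma sot_nbhs_close (S : bounded_op X Y) C e : finite_set C -> 0 < e ->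
  nbhs (S : sot_op X Y) [set S' : bounded_op X Y | close_on C e S S'].
Proof.
move=> /finite_seqP[r ->] e0; elim: r => [|x r IH].
  by apply: filterS filterT => S' _ x; rewrite /= in_nil.
have ev : continuous (fun S' : sot_op X Y => (S' : bounded_op X Y) x).
  move=> S'; apply: (@continuous_comp (sot_op X Y) {ptws X -> Y} Y
     (fun S' : sot_op X Y => bop_fun S') (fun g => g x)).
    exact: initial_continuous.
  exact: proj_continuous.
have FS : Filter (nbhs (S : sot_op X Y)) := nbhs_filter (S : sot_op X Y).
have Sx := (cvgrPdist_lt (FF := FS) _ _).1 (ev S) e e0.
apply: filterS (filterI Sx IH) => S' [/= H1 H2] y /=.
by rewrite in_cons => /orP[/eqP->//|]; exact: H2.
Qed.

Lemma cot_nbhs_close (S : bounded_op X Y) C e : compact C -> 0 < e ->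
  nbhs (S : cot_op X Y) [set S' : bounded_op X Y | close_on C e S S'].
Proof.
move=> cC e0; have entE := @entourage_ball K Y (PosNum e0).
have := @fam_nbhs _ _ compact C _ (bop_fun S) entE cC.
have FS : Filter (nbhs (S : cot_op X Y)) := nbhs_filter (S : cot_op X Y).
move=> /(@initial_continuous _ _ (fun S' : bounded_op X Y =>
  (bop_fun S' : {family compact, X -> Y})) S).
apply: (@filterS _ _ FS) => S' /= SS' x Cx.
by have := SS' x Cx; rewrite -ball_normE.
Qed.

End operator_topologies.

Section conjugation.
Context {R : realType} {s : scalars}.
Local Notation K := (scalar_field R s).

Lemma bounded_op_continuous {X Y : normedModType K} (S : bounded_op X Y) :
  continuous S.
Proof.
apply: bounded_linear_continuous; apply/linear_boundedP.
have [M M0 SM] := bop_bounded S.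
near=> r => x; rewrite (le_trans (SM x))// ler_wpM2r//.
by near: r; apply: nbhs_pinfty_ge; rewrite ger0_real.
Unshelve. all: by end_near. Qed.

(** Near covering by the sets where the norm is at most [M], as [M] grows. *)
Lemma compact_norm_bounded {X : normedModType K} (C : set X) : compact C ->
  exists M : K, forall x, C x -> `|x| <= M.
Proof.
move=> /compact_near_coveringP cC.
have H := cC K (pinfty_nbhs K) (fun M x => `|x| <= M) _ _.
suff /filter_ex[M HM] : \forall M \near pinfty_nbhs K, C `<=` (fun x => `|x| <= M).
  by exists M.
apply: H => x Cx; exists (ball x 1, [set M | `|x| + 1 <= M]).
  split; first exact: nbhsx_ballx.
  by apply: nbhs_pinfty_ge; rewrite realD.
move=> [y M] [/=]; rewrite -ball_normE /= => xy xM; apply: le_trans xM.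
by rewrite -(subrK x y) addrC (le_trans (ler_normD _ _))// lerD2l distrC ltW.
Qed.

Context {X Y : normedModType K} (A : bounded_op Y Y) (B : bounded_op X X).

Lemma conj_op_linear : linear (conj_op A B : bounded_op X Y -> bounded_op X Y).
Proof.
move=> c S1 S2; apply: val_inj; apply/funext => x /=.
change (A (c *: S1 (B x) + S2 (B x)) = c *: A (S1 (B x)) + A (S2 (B x))).
exact: linearP.
Qed.

Lemma conj_op_close (C : set X) (e : K) : 0 < e -> exists2 d : K, 0 < d &
  forall S S' : bounded_op X Y, close_on (B @` C) d S S' ->
    close_on C e (conj_op A B S) (conj_op A B S').
Proof.
move=> e0; have [M M0 AM] := bop_bounded A; have M1 : 0 < M + 1 by rewrite ltr_wpDl.
exists (e / (M + 1)); first exact: divr_gt0.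
move=> S S' SS' x Cx.
change (`|A (S (B x)) - A (S' (B x))| < e); rewrite -linearB.
apply: le_lt_trans (AM _) _; rewrite mulrC; apply: (@scaled_lt _ _ _ M) => //.
by apply: ltW; apply: SS'; exists x.
Qed.

Lemma conj_op_sot_continuous :
  continuous (conj_op A B : sot_op X Y -> sot_op X Y).
Proof.
move=> S U /sot_nbhs_basis[C [e [Cfin e0 CU]]].
have [d d0 H] := conj_op_close C e0.
have := sot_nbhs_close S (finite_image B Cfin) d0.
by apply: filterS => S' SS'; apply: CU; exact: H.
Qed.

Lemma conj_op_cot_continuous :
  continuous (conj_op A B : cot_op X Y -> cot_op X Y).
Proof.
move=> S U /cot_nbhs_basis[C [e [cC e0 CU]]].
have [d d0 H] := conj_op_close C e0.
have cBC : compact (B @` C).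
  by apply: continuous_compact => //; apply: continuous_subspaceT; exact: bounded_op_continuous.
have := cot_nbhs_close S cBC d0.
by apply: filterS => S' SS'; apply: CU; exact: H.
Qed.

Lemma conj_op_bounded_linear :
  (conj_op A B : bounded_op X Y -> bounded_op X Y) \in bounded_linear.
Proof.
apply/mem_set; split; first exact: conj_op_linear.
have [M M0 AM] := bop_bounded A; have [N N0 BN] := bop_bounded B.
exists (M * N) => S; apply: op_norm_lub => x x1.
apply: le_trans (AM _) _; rewrite -mulrA ler_wpM2l//.
apply: le_trans (op_normP S (B x)) _; rewrite mulrC.
apply: (@ler_wpM2r _ (op_norm S)); first exact: op_norm_ge0.
by rewrite (le_trans (BN x))// ler_piMr.
Qed.

Lemma conj_compact_op_linear : linear (@conj_compact_op R s X Y A B).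
Proof. by move=> c S1 S2; apply: val_inj; exact: conj_op_linear. Qed.

Lemma conj_compact_op_continuous : continuous (@conj_compact_op R s X Y A B).
Proof.
pose L := BoundedOp _ conj_op_bounded_linear; have [M M0 LM] := bop_bounded L.
move=> S; have FS : Filter (nbhs S) := nbhs_filter S.
apply/(cvgrPdist_lt (FF := FS)) => e e0; have M1 : 0 < M + 1 by rewrite ltr_wpDl.
have : nbhs S (ball S (e / (M + 1))) by exact/nbhsx_ballx/divr_gt0.
apply: (@filterS _ _ FS) => S'; rewrite -ball_normE /= => SS'.
have LS : `|L (val S) - L (val S')| < e.
  rewrite -linearB; apply: le_lt_trans (LM _) _; rewrite mulrC.
  by apply: (@scaled_lt _ _ _ M) => //; exact: ltW.
exact: LS.
Qed.

End conjugation.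

(** * Conjugation operators *)

Lemma q_lower_density_le (R : realType) q (M M' : set nat) : M `<=` M' ->
  (@q_lower_density R q M <= @q_lower_density R q M')%E.
Proof.
move=> MM'; rewrite /q_lower_density !limn_einf_lim.
apply: lee_lim; [exact: is_cvg_einfs|exact: is_cvg_einfs|].
near=> n; apply: le_ereal_inf_tmp => _ [k /= nk <-].
apply: ge_ereal_inf; eexists; first by exists k.
rewrite lee_fin ler_wpM2r ?invr_ge0// ler_nat; apply: sub_count => i.
by move=> /set_mem/MM'/mem_set.
Unshelve. all: by end_near. Qed.

Lemma countable_seq {T : Type} (A : set T) : countable A -> A !=set0 ->
  exists f : nat -> T, (forall n, A (f n)) /\ forall a, A a -> exists n, f n = a.
Proof.
move=> /countable_injP[g ginj] [a0 Aa0].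
have ex n : exists a, A a /\ ((exists2 b, A b & g b = n) -> g a = n).
  have [[b Ab gb]|nex] := pselect (exists2 b, A b & g b = n); first by exists b.
  by exists a0; split.
have [f fP] := choice ex; exists f; split=> [n|a Aa]; first by case: (fP n).
exists (g a); have [Af] := fP (g a) => /(_ (ex_intro2 _ _ a Aa erefl)).
by apply: ginj; exact/mem_set.
Qed.

Section sequences_in_dense_sets.
Context {R : realType} {s : scalars}.
Local Notation K := (scalar_field R s).

Lemma dense_near {Y : normedModType K} (D : set Y) : dense D ->
  forall y (e : K), 0 < e -> exists2 d, D d & `|y - d| < e.
Proof.
move=> Dd y e e0; have [|d [yd Dd']] := Dd (ball y e) _ (ball_open y e).
  by exists y; exact: ballxx.
by exists d => //; rewrite -ball_normE in yd.
Qed.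

Lemma separable_dense_seq {Y : normedModType K} (D : set Y) :
  separable Y -> dense D ->
  exists d : nat -> Y, (forall n, D (d n)) /\
    forall y (e : K), 0 < e -> exists n, `|y - d n| < e.
Proof.
move=> [A [Acount Adense]] Ddense.
have Aex : A !=set0.
  by have [a Aa _] := dense_near Adense 0 ltr01; exists a.
have [a [Aa asurj]] := countable_seq Acount Aex.
have ex (p : nat * nat) : exists y, D y /\ `|a p.1 - y| < 2 ^- p.2.
  have [|y Dy ay] := @dense_near _ _ Ddense (a p.1) (2 ^- p.2).
    by rewrite invr_gt0 exprn_gt0.
  by exists y.
have [f fP] := choice ex.
exists (fun n => f (odflt (0, 0)%N (choice.unpickle n))); split.
  by move=> n; case: (fP (odflt (0, 0)%N (choice.unpickle n))).
move=> y e e0; have e20 : 0 < e / 2 by rewrite divr_gt0.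
have [b Ab yb] := dense_near Adense y e20; have [i ib] := asurj b Ab.
have [k ke] := half_pow_lt e20.
exists (choice.pickle (i, k)); rewrite choice.pickleK /=.
rewrite -(subrKA b) (le_lt_trans (ler_normD _ _))// [e]splitr ltrD//.
by have [_] := fP (i, k); rewrite /= ib => /lt_trans; apply.
Qed.

Lemma unconditional0 {E : normedModType K} :
  unconditionally_cvg_uniformly (fun _ _ : nat => 0 : E).
Proof. by move=> d d0; exists 1%N => // F _ r; rewrite big1 ?normr0. Qed.

Lemma unconditionalD {E : normedModType K} (x y : nat -> nat -> E) :
  unconditionally_cvg_uniformly x -> unconditionally_cvg_uniformly y ->
  unconditionally_cvg_uniformly (fun n r => x n r + y n r).
Proof.
move=> ux uy d d0; have d20 : 0 < d / 2 by rewrite divr_gt0.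
have [N N0 xN] := ux _ d20; have [M M0 yM] := uy _ d20.
exists (maxn N M); first by rewrite leq_max N0.
move=> F FNM r; rewrite big_split (le_lt_trans (ler_normD _ _))// [d]splitr ltrD//.
  by apply: xN => n /FNM; apply: leq_trans; exact: leq_maxl.
by apply: yM => n /FNM; apply: leq_trans; exact: leq_maxr.
Qed.

Lemma unconditional_sum {E : normedModType K} I (l : seq I)
    (x : I -> nat -> nat -> E) :
  (forall i, unconditionally_cvg_uniformly (x i)) ->
  unconditionally_cvg_uniformly (fun n r => \sum_(i <- l) x i n r).
Proof.
move=> ux; elim: l => [|i l IH].
  rewrite (_ : (fun _ _ => _) = fun _ _ => 0); first exact: unconditional0.
  by apply/funext => n; apply/funext => r; rewrite big_nil.
rewrite (_ : (fun _ _ => _) = fun n r => x i n r + \sum_(j <- l) x j n r).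
  exact: unconditionalD.
by apply/funext => n; apply/funext => r; rewrite big_cons.
Qed.

End sequences_in_dense_sets.

Section frequent_visits.
Context {F : realType} {s : scalars}.
Local Notation K := (scalar_field F s).

Lemma iter_conj_op_rank_one {X Y : normedModType K} (R : bounded_op Y Y)
    (T : bounded_op X X) n (y : Y) (phi : dual X) :
  iter n (conj_op R T) (rank_one y phi) =
  rank_one (iter n R y) (iter n (adjoint T) phi).
Proof.
elim: n => //= n ->; apply: val_inj; apply/funext => x /=.
by rewrite linearZ.
Qed.

(** The criterion is applied to conjugation on the Banach space of bounded
    operators, with the finite sums of the [y (x) phi] as targets. Conjugation
    maps [y (x) phi] to [R y (x) (adjoint T) phi], so the hypotheses of the
    criterion hold term by term. Targets are indexed by codes of finite lists of
    pairs, whence a countable dense subset [D0] of [D]. *)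
Lemma exists_frequent_visitor {X Y : completeNormedModType K}
    (sepY : separable Y)
    (R : bounded_op Y Y) (T : bounded_op X X) (q : nat) (q_gt0 : (0 < q)%N)
    (D : set Y) (denseD : dense D)
    (Phi : set (dual X)) (countablePhi : countable Phi) (Phi0 : Phi !=set0)
    (ys : Y -> dual X -> nat -> Y) (xs : Y -> dual X -> nat -> dual X)
    (hyp_a : forall (y : Y) (phi : dual X), D y -> Phi phi ->
      unconditionally_cvg_uniformly (fun n r : nat =>
        if (n <= r)%N then
          rank_one (iter (r ^ q - (r - n) ^ q)%N R y)
                   (iter (r ^ q - (r - n) ^ q)%N (adjoint T) phi)
        else 0 : bounded_op X Y) /\
      unconditionally_cvg_uniformly (fun n r : nat =>
        rank_one (ys y phi ((n + r) ^ q - r ^ q)%N)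
                 (xs y phi ((n + r) ^ q - r ^ q)%N) : bounded_op X Y))
    (hyp_b : forall (y : Y) (phi : dual X), D y -> Phi phi ->
      forall m n : nat, (n < m)%N ->
      [/\ iter (n ^ q)%N R (ys y phi (n ^ q)%N) = y,
          iter (n ^ q)%N (adjoint T) (xs y phi (n ^ q)%N) = phi,
          iter (n ^ q)%N R (ys y phi (m ^ q)%N)
            = ys y phi (m ^ q - n ^ q)%N
        & iter (n ^ q)%N (adjoint T) (xs y phi (m ^ q)%N)
            = xs y phi (m ^ q - n ^ q)%N]) :
  exists D0 : set Y, (forall y (e : K), 0 < e -> exists2 d, D0 d & `|y - d| < e) /\
  exists2 S : bounded_op X Y, S \in is_compact_op &
  forall v (e : K), tensors D0 Phi v -> 0 < e ->
    (0 < @q_lower_density F q [set n | (`|iter n (conj_op R T) S - v| < e)%R])%E.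
Proof.
have [d [dD dd]] := separable_dense_seq sepY denseD.
have [f [fPhi fsurj]] := countable_seq countablePhi Phi0.
exists (range d); split.
  by move=> y e e0; have [n dn] := dd y e e0; exists (d n) => //; exists n.
pose C : bounded_op (bounded_op X Y) (bounded_op X Y) :=
  BoundedOp _ (conj_op_bounded_linear R T).
have iterC n l (v : nat * nat -> bounded_op X Y) :
    iter n C (\sum_(z <- l) v z) = \sum_(z <- l) iter n C (v z).
  exact: (linear_sum (BoundedOp _ (iter_bounded_linear C n))).
pose code k : seq (nat * nat) := odflt [::] (choice.unpickle k).
pose w k : bounded_op X Y := \sum_(z <- code k) rank_one (d z.1) (f z.2).
pose sigma k n : bounded_op X Y :=
  \sum_(z <- code k) rank_one (ys (d z.1) (f z.2) n) (xs (d z.1) (f z.2) n).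
have hyps (z : nat * nat) := hyp_a _ _ (dD z.1) (fPhi z.2).
have hypb (z : nat * nat) m n := hyp_b _ _ (dD z.1) (fPhi z.2) m n.
have [|k|k n|k m n nm|S [SP Svisits]] :=
  @q_frequent_hypercyclicity_criterion _ _ _ C q q_gt0 w sigma.
- move=> k; pose x (z : nat * nat) (n r : nat) : bounded_op X Y :=
    if (n <= r)%N then
      rank_one (iter (r ^ q - (r - n) ^ q)%N R (d z.1))
               (iter (r ^ q - (r - n) ^ q)%N (adjoint T) (f z.2)) else 0.
  have := @unconditional_sum _ _ _ _ (code k) x (fun z => (hyps z).1).
  congr (unconditionally_cvg_uniformly _).
  apply/funext => n; apply/funext => r; rewrite /x; case: ifP => _.
    by rewrite iterC; apply: eq_bigr => z _; rewrite -iter_conj_op_rank_one.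
  by rewrite big1.
- exact: unconditional_sum (fun z => (hyps z).2).
- rewrite iterC; apply: eq_bigr => z _.
  rewrite [LHS]iter_conj_op_rank_one.
  by have [-> -> _ _] := hypb z _ _ (ltnSn n).
- rewrite iterC; apply: eq_bigr => z _.
  rewrite [LHS]iter_conj_op_rank_one.
  by have [_ _ -> ->] := hypb z _ _ nm.
exists S.
  apply: (SP [set S : bounded_op X Y | S \in is_compact_op]).
  - move=> S1 clS1; apply: compact_op_closed => e e0.
    have [S2 [S2c]] := clS1 _ (nbhsx_ballx S1 _ e0).
    by rewrite -ball_normE; exists S2.
  - exact: rpred0.
  - by move=> u v uc vc; exact: rpredD.
  - by move=> k n; apply: rpred_sum => z _; exact: rank_one_compact.
move=> _ e [l [lP ->]] e0.
have [l' ->] : exists l' : seq (nat * nat),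
    tensor_sum l = \sum_(z <- l') rank_one (d z.1) (f z.2) :> bounded_op X Y.
  elim: l lP => [|[y phi] l IH] lP.
    by exists [::]; rewrite /tensor_sum !big_nil.
  have [z zl|l' El'] := IH; first by apply: lP; rewrite in_cons zl orbT.
  have [[i _ di] Pphi] := lP (y, phi) (mem_head _ _).
  have [j fj] := fsurj _ Pphi.
  exists ((i, j) :: l'); rewrite big_cons -El' /tensor_sum big_cons /=.
  by rewrite di fj.
by have := Svisits (choice.pickle l') e e0; rewrite /w /code choice.pickleK.
Qed.

End frequent_visits.

(** Visits to norm balls around the elements of [V] are visits to the
    neighbourhoods of [S0] for uniform convergence on bounded sets, as soon as
    [V] comes close to [S0] on these sets. *)
Lemma approx_visit {F : realType} {s : scalars}
    {X Y : normedModType (scalar_field F s)} (C : set X)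
    (V : set (bounded_op X Y)) (S0 S : bounded_op X Y) q
    (A : bounded_op X Y -> bounded_op X Y) (M e : scalar_field F s)
    (U : set (bounded_op X Y)) :
  (forall x, C x -> `|x| <= M) -> 0 < e ->
  approx_on C V S0 ->
  (forall v (d : scalar_field F s), V v -> 0 < d ->
    (0 < @q_lower_density F q [set n | (`|iter n A S - v| < d)%R])%E) ->
  (forall S' : bounded_op X Y, close_on C e S0 S' -> U S') ->
  (0 < @q_lower_density F q [set n | U (iter n A S)])%E.
Proof.
move=> CM e0 S0V visits CU; have e20 : 0 < e / 2 by rewrite divr_gt0.
have [v Vv S0v] := S0V _ e20.
have M1 : 0 < `|M| + 1 by rewrite ltr_wpDl.
apply: lt_le_trans (visits v _ Vv (divr_gt0 e20 M1)) _.
apply: q_lower_density_le => n /= nv; apply: CU => x Cx.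
have xM := CM x Cx.
rewrite -(subrKA (v x)) (le_lt_trans (ler_normD _ _))// [e]splitr ltrD//; first exact: S0v.
rewrite distrC; apply: le_lt_trans (op_normP (iter n A S - v) x) _.
apply: (@scaled_lt _ _ _ `|M|) => //; [exact: op_norm_ge0|exact: ltW|].
by rewrite ger0_norm//; exact: le_trans xM.
Qed.

Lemma weak_star_dense_near {F : realType} {s : scalars}
    {X : normedModType (scalar_field F s)} (Phi : set (dual X)) (r : seq X) :
  dense (Phi : set (weak_star_dual X)) ->
  forall (psi : dual X) (e : scalar_field F s), 0 < e ->
  exists2 phi, Phi phi & forall x, x \in r -> `|psi x - phi x| < e.
Proof.
move=> Phid psi e e0.
have fr : finite_set [set` r] by apply/finite_seqP; exists r.
have := sot_nbhs_close psi fr e0; rewrite nbhsE => -[W [Wop Wpsi] WC].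
have [|phi [Wphi Phiphi]] := Phid W _ Wop; first by exists psi.
by exists phi => // x xr; exact: WC.
Qed.

Theorem theorem3p3 (F : realType) (s : scalars)
    (X Y : completeNormedModType (scalar_field F s))
    (sepX : separable X) (sepY : separable Y)
    (R : bounded_op Y Y) (T : bounded_op X X) (q : nat) (q_gt0 : (0 < q)%N)
    (D : set Y) (denseD : dense D)
    (Phi : set (dual X)) (countablePhi : countable Phi)
    (weak_star_densePhi : dense (Phi : set (weak_star_dual X)))
    (* the sequences (y_n) and (x_n^* ) associated with (y, x^* ) *)
    (ys : Y -> dual X -> nat -> Y) (xs : Y -> dual X -> nat -> dual X)
    (hyp_a : forall (y : Y) (phi : dual X), D y -> Phi phi ->
      unconditionally_cvg_uniformly (fun n r : nat =>
        if (n <= r)%N then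
          rank_one (iter (r ^ q - (r - n) ^ q)%N R y)
                   (iter (r ^ q - (r - n) ^ q)%N (adjoint T) phi)
        else 0 : bounded_op X Y) /\
      (* N >= 1 in the definition of convergence, so the term n = 0 is absent *)
      unconditionally_cvg_uniformly (fun n r : nat =>
        rank_one (ys y phi ((n + r) ^ q - r ^ q)%N)
                 (xs y phi ((n + r) ^ q - r ^ q)%N) : bounded_op X Y))
    (hyp_b : forall (y : Y) (phi : dual X), D y -> Phi phi ->
      forall m n : nat, (n < m)%N ->
      [/\ iter (n ^ q)%N R (ys y phi (n ^ q)%N) = y,
          iter (n ^ q)%N (adjoint T) (xs y phi (n ^ q)%N) = phi,
          iter (n ^ q)%N R (ys y phi (m ^ q)%N)
            = ys y phi (m ^ q - n ^ q)%N
        & iter (n ^ q)%N (adjoint T) (xs y phi (m ^ q)%N)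
            = xs y phi (m ^ q - n ^ q)%N]) :
  (adjoint T @` Phi `<=` Phi ->
   (forall (y : Y) (phi : dual X), D y -> Phi phi ->
      range (xs y phi) `<=` Phi) ->
   q_frequently_hypercyclic q (conj_op R T : sot_op X Y -> sot_op X Y)) /\
  (approximation_property Y -> dense Phi ->
   q_frequently_hypercyclic q
     (conj_compact_op R T : compact_op X Y -> compact_op X Y) /\
   q_frequently_hypercyclic q (conj_op R T : cot_op X Y -> cot_op X Y)).
Proof.
have [phi0 Phi0] : Phi !=set0.
  have [|phi [_ Phiphi]] := weak_star_densePhi setT _ openT; first by exists 0.
  by exists phi.
have Phi_ex : Phi !=set0 by exists phi0.
have [D0 [D0d [S Scompact visits]]] :=
  exists_frequent_visitor sepY q_gt0 denseD countablePhi Phi_ex hyp_a hyp_b.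
split=> [_ _|AP Phid].
  split; [exact: conj_op_linear|exact: conj_op_sot_continuous|exists S].
  move=> U Uop [S0 US0].
  have [_ [e [/finite_seqP[r ->] e0 CU]]] :=
    sot_nbhs_basis (open_nbhs_nbhs (conj Uop US0)).
  apply: (@approx_visit _ _ _ _ [set` r] (tensors D0 Phi) S0 S q (conj_op R T)
    (\sum_(x <- r) `|x|) e U) => //.
    by move=> x /= xr; rewrite (big_rem x)//= lerDl sumr_ge0.
  by apply: approx_on_finite => //; exact: weak_star_dense_near.
have Phin := dense_near Phid.
split.
  split; [exact: conj_compact_op_linear|exact: conj_compact_op_continuous|].
  exists (CompactOp Scompact) => U Uop [S0 US0].
  have /nbhs_ballP[e e0 eU] : nbhs S0 U by exact: open_nbhs_nbhs.
  have iterE n : val (iter n (conj_compact_op R T) (CompactOp Scompact)) =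
      iter n (conj_op R T) S by elim: n => //= n <-.
  have e20 : 0 < e / 2 by rewrite divr_gt0.
  (* [U] seen among all bounded operators: non-compact ones are admitted, so
     that closeness to [S0] alone implies membership. *)
  pose V : set (bounded_op X Y) :=
    [set S' | forall S1 : compact_op X Y, val S1 = S' -> U S1].
  apply: (@lt_le_trans _ _ (@q_lower_density F q [set n | V (iter n (conj_op R T) S)])).
    apply: (@approx_visit _ _ _ _ [set x | `|x| <= 1] (tensors D0 Phi) (val S0) S q
      (conj_op R T) 1 (e / 2) V) => //.
      apply: (@approx_on_approximation_property _ _ _ _ _ _ _ _ 1) => //.
      have /compact_opP[C cC SC] := cop_opP S0.
      by exists C.
    move=> S' S0S' S1 S1E; apply: eU; rewrite -ball_normE /=.
    apply: (@le_lt_trans _ _ (e / 2)); last by rewrite gtr_pMr// invf_lt1 ?ltr1n.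
    apply: op_norm_lub => x x1; apply: ltW.
    by have := S0S' x x1; rewrite -S1E.
  by apply: q_lower_density_le => n Vn; apply: Vn; exact: iterE.
split; [exact: conj_op_linear|exact: conj_op_cot_continuous|exists S].
move=> U Uop [S0 US0].
have [C [e [cC e0 CU]]] := cot_nbhs_basis (open_nbhs_nbhs (conj Uop US0)).
have [M CM] := compact_norm_bounded cC.
apply: (@approx_visit _ _ _ _ C (tensors D0 Phi) S0 S q (conj_op R T) M e U) => //.
apply: (@approx_on_approximation_property _ _ _ _ _ _ _ _ M) => //.
exists (S0 @` C); last by move=> x Cx; exists x.
apply: continuous_compact => //; apply: continuous_subspaceT.
exact: bounded_op_continuous.
Qed.
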